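(* Let $U$ be a compact connected semisimple Lie group and let $\mathbb{F}_\Theta=\mathrm{Ad}(U)(iH)$ be a flag with dual flag $\mathbb{F}_{\Theta^*}=\mathrm{Ad}(U)(i\sigma(H))$. Inside the product $\mathbb{F}_\Theta\times\mathbb{F}_{\Theta^*}$, for each $m\in U$, there exists a unique isotropic orbit of the action of the subgroup $\Delta^m=\{(u,mum^{-1}):u\in U\}\subset U\times U$. Such an orbit is Lagrangian and it is given by the graph of the map $-\mathrm{Ad}(m):\mathrm{Ad}(U)(iH)\to\mathrm{Ad}(U)(i\sigma(H))$.
   Context: Let $\mathfrak{u}$ be the Lie algebra of $U$, $\langle\cdot,\cdot\rangle$ its Cartan--Killing form, $\mathfrak{t}=i\mathfrak{h}_{\mathbb{R}}$ the Lie algebra of a maximal torus; $H$ lies in the closure of the positive Weyl chamber of $\mathfrak{h}_{\mathbb{R}}$. The flags of the complex group with Lie algebra $\mathfrak{u}_{\mathbb{C}}$ are realized as adjoint orbits of $U$ in $\mathfrak{u}$, each with the Kirillov--Kostant--Souriau symplectic form $\omega_x([X,x],[Y,x])=\langle x,[X,Y]\rangle$; the product has the product symplectic form (sum of pullbacks from the factors). $\sigma=-w_0$ with $w_0$ the longest element of the Weyl group, so that $\mathrm{Ad}(U)(i\sigma(H))=\mathrm{Ad}(U)(-iH)$, and $\Theta^*=\sigma\Theta$. The subgroup $\Delta^m$ acts by restriction of the action $(u_1,u_2)\cdot(x,y)=(\mathrm{Ad}(u_1)x,\mathrm{Ad}(u_2)y)$ of $U\times U$. A submanifold is isotropic if the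 symplectic form restricts to zero on it, and Lagrangian if moreover it has half the dimension of the ambient manifold. *)

(* Defs.v *)
From HB Require Import structures.
From mathcomp Require Import all_boot all_order all_algebra.
From mathcomp Require Import all_classical all_reals all_analysis.

Set Implicit Arguments.
Unset Strict Implicit.
Unset Printing Implicit Defensive.

Import Order.TTheory GRing.Theory Num.Theory.
Import numFieldNormedType.Exports.

Local Open Scope classical_set_scope.
Local Open Scope ring_scope.

(** ** Lie groups *)

(* [f] is of class C^k on the set [A], which is always open in the uses below:
   C^0 is continuity, and C^(k+1) is differentiability together with all the
   directional derivatives being of class C^k. *)
Fixpoint Ck (R : realType) (m n k : nat) (A : set 'rV[R]_m)
    (f : 'rV[R]_m -> 'rV[R]_n) : Prop :=
  match k with
  | 0 => forall x, A x -> {for x, continuous f}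
  | k'.+1 => (forall x, A x -> differentiable f x) /\
             (forall v, Ck k' A (fun x => 'D_v f x))
  end.

Definition smooth (R : realType) (m n : nat) (A : set 'rV[R]_m)
    (f : 'rV[R]_m -> 'rV[R]_n) : Prop :=
  forall k, Ck k A f.

(* A chart is a homeomorphism from the open set [cdom] onto an open subset of
   R^n; [cmap] and [cinv] are meaningful on [cdom] and its image only. *)
Record chart (R : realType) (n : nat) (G : topologicalType) := Chart {
  cdom : set G;
  cmap : G -> 'rV[R]_n;
  cinv : 'rV[R]_n -> G;
  cdom_open : open cdom;
  cimg_open : open (cmap @` cdom);
  cmapK : forall x, cdom x -> cinv (cmap x) = x;
  cmap_continuous : forall x, cdom x -> {for x, continuous cmap};
  cinv_continuous : forall x, cdom x -> {for cmap x, continuous cinv}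
}.

Definition cimg (R : realType) (n : nat) (G : topologicalType)
    (a : chart R n G) : set 'rV[R]_n :=
  cmap a @` cdom a.

(* An n-dimensional smooth manifold structure on a topological group whose
   multiplication and inversion are smooth when read in charts. *)
HB.mixin Record isLieGroup (R : realType) (n : nat) G
    of Topological G & Group G := {
  atlas : set (chart R n G);
  lie_hausdorff : hausdorff_space G;
  lie_second_countable : @second_countable G;
  atlas_cover : forall x : G, exists2 a, atlas a & cdom a x;
  atlas_smooth : forall a b, atlas a -> atlas b ->
    smooth (cimg a `&` cinv a @^-1` cdom b) (cmap b \o cinv a);
  lie_mul_continuous : continuous (fun p : G * G => (p.1 * p.2)%g);
  lie_inv_continuous : continuous (fun x : G => (x^-1)%g);
  lie_mul_smooth : forall a b c, atlas a -> atlas b -> atlas c ->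
    let mul (p : 'rV[R]_(n + n)) :=
      (cinv a (lsubmx p) * cinv b (rsubmx p))%g in
    smooth [set p | [/\ cimg a (lsubmx p), cimg b (rsubmx p)
                      & cdom c (mul p)]]
           (fun p => cmap c (mul p));
  lie_inv_smooth : forall a c, atlas a -> atlas c ->
    let inv (p : 'rV[R]_n) := ((cinv a p)^-1)%g in
    smooth (cimg a `&` inv @^-1` cdom c) (cmap c \o inv)
}.

#[short(type="lieGroupType")]
HB.structure Definition LieGroup (R : realType) (n : nat) :=
  { G of Topological G & Group G & isLieGroup R n G }.

(* A chart at the identity.  It identifies the tangent space of the group at
   the identity with R^n, and all the notions of Lie algebra below are read
   through this identification. *)
Definition chart_at_one (R : realType) (n : nat) (U : lieGroupType R n)
    (phi : chart R n U) : Prop :=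
  atlas phi /\ cdom phi 1%g.

Section LieAlgebra.
Variables (R : realType) (n : nat) (U : lieGroupType R n).
Variable (phi : chart R n U).

Local Notation u := 'rV[R]_n.

(* Ad(g) is the differential at the identity of x |-> g x g^-1. *)
Definition Ad (g : U) (X : u) : u :=
  'D_X (fun p => cmap phi (g * cinv phi p * g^-1)%g) (cmap phi 1%g).

(* [X, Y] = ad(X) Y, where ad is the differential of Ad at the identity. *)
Definition bracket (X Y : u) : u :=
  'D_X (fun p => Ad (cinv phi p) Y) (cmap phi 1%g).

Definition killing (X Y : u) : R :=
  \tr (lin1_mx (fun Z : u => bracket X (bracket Y Z))).

(* Semisimplicity in the sense of Helgason: the Killing form of the Lie algebra
   is nondegenerate. *)
Definition semisimple : Prop :=
  forall X : u, (forall Y : u, killing X Y = 0) -> X = 0.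

(** ** Maximal tori, roots and the Weyl group *)

Definition is_subgroup (T : set U) : Prop :=
  T 1%g /\ forall x y, T x -> T y -> T (x * y^-1)%g.

(* As closed subgroups of a compact group are compact Lie groups, the tori of a
   compact group are its closed connected abelian subgroups. *)
Definition torus (T : set U) : Prop :=
  [/\ is_subgroup T, closed T, connected T
    & forall x y, T x -> T y -> (x * y = y * x)%g].

Definition maximal_torus (T : set U) : Prop :=
  torus T /\ forall T', torus T' -> T `<=` T' -> T' = T.

(* The Lie algebra of a closed subgroup: the velocities of the one-parameter
   subgroups of U contained in it. *)
Definition lie_of (T : set U) : set u :=
  [set X | exists gamma : R -> U,
     [/\ continuous gamma,
         forall s t, gamma (s + t) = (gamma s * gamma t)%g,
         forall t, T (gamma t)
       & is_derive (0 : R) (1 : R) (cmap phi \o gamma) X]].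

Definition normalizer (T : set U) : set U :=
  [set g | forall x, T (g * x * g^-1)%g <-> T x].

(* The complexification of u: the pair (X, Y) stands for X + i Y. *)
Local Notation uC := (u * u)%type.

Definition imul (Z : uC) : uC := (- Z.2, Z.1).

Definition bracketC (Z W : uC) : uC :=
  (bracket Z.1 W.1 - bracket Z.2 W.2, bracket Z.1 W.2 + bracket Z.2 W.1).

Definition AdC (g : U) (Z : uC) : uC := (Ad g Z.1, Ad g Z.2).

(* The real part of the Killing form of the complexification; the imaginary
   part vanishes on the real form h_R below. *)
Definition killingC (Z W : uC) : R := killing Z.1 W.1 - killing Z.2 W.2.

Variable T : set U.

(* The space h_R such that t = i h_R. *)
Definition hR : set uC :=
  [set H | exists2 X, lie_of T X & imul H = (X, 0)].

(* Roots are functions on h_R; the values outside h_R are irrelevant. *)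
Definition is_root (alpha : uC -> R) : Prop :=
  (exists2 H, hR H & alpha H != 0) /\
  exists2 Z : uC, Z != 0 &
    forall H, hR H -> bracketC H Z = alpha H *: Z.

Definition simple_system (r : nat) (Sigma : 'I_r -> uC -> R) : Prop :=
  [/\ forall i, is_root (Sigma i),
      forall c : 'I_r -> R,
        (forall H, hR H -> \sum_i c i * Sigma i H = 0) -> forall i, c i = 0
    & forall alpha, is_root alpha ->
        exists c : 'I_r -> nat,
          (forall H, hR H -> alpha H = \sum_i (c i)%:R * Sigma i H) \/
          (forall H, hR H -> alpha H = - \sum_i (c i)%:R * Sigma i H)].

Definition positive_chamber (r : nat) (Sigma : 'I_r -> uC -> R) : set uC :=
  [set H | hR H /\ forall i, 0 < Sigma i H].

(* The vector H_alpha of h_R with alpha = <H_alpha, . > on h_R. *)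
Definition dual_vector (alpha : uC -> R) : uC :=
  xget 0 [set A | hR A /\ forall H, hR H -> alpha H = killingC A H].

Definition reflection (alpha : uC -> R) (H : uC) : uC :=
  H - (2 * alpha H / alpha (dual_vector alpha)) *: dual_vector alpha.

(* The Weyl group is N(T)/T acting on h_R through AdC.  The next definitions
   give the length of the class of an element g of N(T) with respect to the
   simple reflections. *)
Definition weyl_word (r : nat) (Sigma : 'I_r -> uC -> R) (g : U)
    (s : seq 'I_r) : Prop :=
  forall H, hR H -> AdC g H = foldr (fun i => reflection (Sigma i)) H s.

Definition weyl_length (r : nat) (Sigma : 'I_r -> uC -> R) (g : U)
    (k : nat) : Prop :=
  (exists2 s, weyl_word Sigma g s & size s = k) /\
  (forall s, weyl_word Sigma g s -> (k <= size s)%N).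

Definition longest (r : nat) (Sigma : 'I_r -> uC -> R) (w0 : U) : Prop :=
  normalizer T w0 /\
  exists2 k, weyl_length Sigma w0 k &
    forall g l, normalizer T g -> weyl_length Sigma g l -> (l <= k)%N.

(* sigma = - w_0, for a representative of w_0 in N(T). *)
Definition sigma (w0 : U) (H : uC) : uC := - AdC w0 H.

(** ** Flags and the symplectic geometry of their products *)

(* The adjoint orbit Ad(U)(i H) in u, for H in h_R (so that i H is in u). *)
Definition flag (H : uC) : set u := [set Ad g (imul H).1 | g in [set: U]].

(* The Kirillov-Kostant-Souriau form on an adjoint orbit,
   omega_x([X, x], [Y, x]) = <x, [X, Y]>. *)
Definition kks (x v w : u) : R :=
  let lift z := xget 0 [set X | bracket X x = z] in
  killing x (bracket (lift v) (lift w)).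

Definition kks_prod (p v w : u * u) : R :=
  kks p.1 v.1 w.1 + kks p.2 v.2 w.2.

Definition act (k : U * U) (p : u * u) : u * u := (Ad k.1 p.1, Ad k.2 p.2).

Definition Delta (m : U) : set (U * U) :=
  [set (g, (m * g * m^-1)%g) | g in [set: U]].

Definition is_orbit (K : set (U * U)) (M N : set (u * u)) : Prop :=
  exists2 p, M p & N = [set act k p | k in K].

(* The tangent vectors at p of a submanifold N of u x u. *)
Definition tangent (N : set (u * u)) (p : u * u) : set (u * u) :=
  [set v | exists gamma : R -> u * u,
     [/\ gamma 0 = p, forall t, N (gamma t)
       & is_derive (0 : R) (1 : R) gamma v]].

(* N has dimension d: at each point, the maximal number of linearly independent
   tangent vectors is d. *)
Definition has_dim (N : set (u * u)) (d : nat) : Prop :=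
  forall p, N p ->
    (exists s : seq (u * u),
       [/\ free s, size s = d & forall v, v \in s -> tangent N p v]) /\
    (forall s : seq (u * u),
       free s -> (forall v, v \in s -> tangent N p v) -> (size s <= d)%N).

(* Both notions are applied to orbits of compact groups, which are always
   submanifolds. *)
Definition isotropic (N : set (u * u)) : Prop :=
  forall p v w, N p -> tangent N p v -> tangent N p w -> kks_prod p v w = 0.

Definition lagrangian (M N : set (u * u)) : Prop :=
  isotropic N /\ exists d, has_dim N d /\ has_dim M d.*2.

End LieAlgebra.

(* Main.v *)
Require Import Defs.
From HB Require Import structures.
From mathcomp Require Import all_boot all_order all_algebra.
From mathcomp Require Import all_classical all_reals all_analysis.
From mathcomp Require Import ring lra.
From mathcomp Require complex.

(** Write x0 for the vector iH of u.  Since sigma is minus a map induced by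
    some Ad(w0), the dual flag is the adjoint orbit of - x0, that is, minus the
    flag.  At a point (x, y) of the product, the tangent vectors of an orbit of
    Delta^m are the pairs ([X, x], [Ad(m) X, y]), and on two of them the form is
      <x, [X, Y]> + <y, [Ad(m) X, Ad(m) Y]> = <x + Ad(m)^-1 y, [X, Y]>
    by invariance of the Killing form.  The form is nondegenerate, so a vector
    orthogonal to all brackets is central, hence zero: the orbit is isotropic
    exactly when y = - Ad(m) x ([isotropic_twisted_orbit], [graph_isotropic]),
    and the orbit of such a point is the graph of - Ad(m)
    ([twisted_orbit_graph]).

    The Lie algebra facts behind this come from differentiating Ad.  Conjugation
    read in the chart is differentiable, so Ad is a linear representation;
    multiplication is C^2, so p |-> Ad(p) Y is differentiable at the identity
    ([Ad_cinv_differentiable]), which makes the bracket bilinear.  Differentiating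
    Ad(g) [X, Y] = [Ad(g) X, Ad(g) Y] gives the Leibniz rule, and antisymmetry
    follows from it by nondegeneracy of the Killing form ([brkxx]).
    These facts, together with the boundedness of Ad on a compact group, are
    collected in [adjoint_rep], and everything else is deduced from that record.

    The remaining point is that tangent vectors are defined by arbitrary curves
    in an orbit, differentiable at one point only; so one must show that the
    velocity v at x of any such curve is of the form [X, x]
    ([orbit_velocity]).  The matrices ad(y), for y on the orbit of x, are all
    conjugate to A = ad(x), hence are killed by the minimal polynomial q of A.
    Differentiating q(ad(gamma(t))) = 0 and taking the trace against a matrix C
    commuting with A gives tr(ad(v) q'(A) C) = 0.  If q is coprime to q', then
    q'(A) is invertible with inverse a polynomial in A, so tr(ad(v) C) = 0; with
    C = ad(Z) this says that v is orthogonal to the centralizer of x, whose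
    orthogonal is the image of ad(x).

    That q is coprime to q' expresses that ad(x) is semisimple, and holds because
    ad(x) generates a bounded group of matrices ([bounded_group_separable]).  The
    supremum N of a norm over the group is an invariant norm on the complexified
    space, and by convexity N(z + s z (A - ib)) >= N(z) for all real s and b,
    which is incompatible with a Jordan block of size two. *)

Set Implicit Arguments.
Unset Strict Implicit.
Unset Printing Implicit Defensive.

Import Order.TTheory GRing.Theory Num.Theory.
Import numFieldNormedType.Exports.

Local Open Scope classical_set_scope.
Local Open Scope ring_scope.

(** * Differentiability of maps between normed spaces *)

Section Differentials.
Variable R : realType.

Lemma near_differentiable (V W : normedModType R) (f g : V -> W) (x : V) :
  (\forall y \near x, f y = g y) -> differentiable f x -> differentiable g x.
Proof.
move=> fg df; have fgx := nbhs_singleton fg.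
have [dc /eqaddoP fE] := (diff_locallyP x f).1 df.
have gE : g \o shift x = cst (g x) + 'd f x +o_ (0 : V) id.
  apply/eqaddoP => e e0; have := fE _ e0.
  have : \forall y \near (0 : V), f (y + x) = g (y + x).
    by move: fg; rewrite (near_shift 0)/= subr0.
  move=> fg0 nf; apply: filterS2 fg0 nf => y fgy.
  by rewrite !fctE /= fgy fgx.
by apply/diff_locallyP; rewrite (diff_unique dc gE).
Qed.

Lemma derive_comp (V W Z : normedModType R) (f : V -> W) (g : W -> Z) (x v : V) :
  differentiable f x -> differentiable g (f x) ->
  'D_v (g \o f) x = 'D_('D_v f x) g (f x).
Proof.
move=> df dg; rewrite (deriveE _ (differentiable_comp df dg)) (diff_comp df dg).
by rewrite (deriveE _ df) (deriveE _ dg).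
Qed.

Lemma is_derive_comp_diff (V W : normedModType R) (f : V -> W) (c : R -> V)
    (t : R) (w : V) :
  is_derive t 1 c w -> differentiable f (c t) ->
  is_derive t 1 (f \o c) ('d f (c t) w).
Proof.
move=> [dc <-] df; have dc' : differentiable c t by exact/derivable1_diffP.
apply: DeriveDef; first exact/derivable1_diffP/differentiable_comp.
by rewrite (deriveE _ (differentiable_comp dc' df)) (deriveE _ dc') diff_comp.
Qed.

Lemma linear_diffE (V W : normedModType R) (f : V -> W) (x : V) :
  linear f -> continuous f -> differentiable f x /\ 'd f x = f :> (V -> W).
Proof.
move=> lf cf; pose fL : {linear V -> W} :=
  HB.pack f (GRing.isLinear.Build _ _ _ _ _ lf).
by split; [exact: (linear_differentiable (f := fL))|exact: (diff_lin (f := fL))].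
Qed.

Lemma is_derive_linear (V W : normedModType R) (f : V -> W) (c : R -> V)
    (t : R) (w : V) : linear f -> continuous f ->
  is_derive t 1 c w -> is_derive t 1 (f \o c) (f w).
Proof.
move=> lf cf dc; have [df dfE] := linear_diffE (c t) lf cf.
by have := is_derive_comp_diff dc df; rewrite dfE.
Qed.

Lemma rV_linear_differentiable (n : nat) (W : normedModType R)
    (f : 'rV[R]_n -> W) (x : 'rV[R]_n) : linear f -> differentiable f x.
Proof.
move=> lf; pose fL : {linear _ -> W} :=
  HB.pack f (GRing.isLinear.Build _ _ _ _ _ lf).
suff -> : f = \sum_j (fun v : 'rV[R]_n => v 0 j *: f (delta_mx 0 j)).
  apply: differentiable_sum => j; apply: differentiableZl.
  exact: differentiable_coord.
apply/funext => v; rewrite -[f]/(fL : _ -> _) [in LHS](row_sum_delta v).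
by rewrite linear_sum fct_sumE; apply: eq_bigr => j _; rewrite linearZ.
Qed.

Lemma rV_linear_continuous (n : nat) (W : normedModType R)
    (f : 'rV[R]_n -> W) : linear f -> continuous f.
Proof.
by move=> lf x; exact/differentiable_continuous/rV_linear_differentiable.
Qed.

Lemma is_derive_line (V : normedModType R) (x v : V) :
  is_derive (0 : R) 1 (fun t : R => x + t *: v) v.
Proof.
have -> : (fun t : R => x + t *: v) = cst x + ( *:%R ^~ v) by [].
have [dd dE] := @is_diff_scalel R V 0 v.
rewrite -[X in is_derive _ _ _ X]add0r; apply: is_deriveD.
by apply: DeriveDef; [exact: diff_derivable|rewrite deriveE // dE /= scale1r].
Qed.

Lemma is_derive_fst (V W : normedModType R) (c : R -> V * W)
    (t : R) (w : V * W) :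
  is_derive t 1 c w -> is_derive t 1 (fun s => (c s).1) w.1.
Proof.
by apply: (@is_derive_linear _ _ (fun p : V * W => p.1)) => // p; apply: cvg_fst.
Qed.

Lemma is_derive_snd (V W : normedModType R) (c : R -> V * W)
    (t : R) (w : V * W) :
  is_derive t 1 c w -> is_derive t 1 (fun s => (c s).2) w.2.
Proof.
by apply: (@is_derive_linear _ _ (fun p : V * W => p.2)) => // p; apply: cvg_snd.
Qed.

Lemma is_derive_pair (V W : normedModType R) (c : R -> V) (d : R -> W)
    (t : R) (v : V) (w : W) :
  is_derive t 1 c v -> is_derive t 1 d w ->
  is_derive t 1 (fun s => (c s, d s)) (v, w).
Proof.
move=> [dc <-] [dd <-].
have dc' : differentiable c t by exact/derivable1_diffP.
have dd' : differentiable d t by exact/derivable1_diffP.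
have dp := differentiable_pair dc' dd'.
apply: DeriveDef; first exact/derivable1_diffP.
by rewrite (deriveE _ dp) (deriveE _ dc') (deriveE _ dd') diff_pair.
Qed.

Lemma is_derive_unique (V W : normedModType R) (f : V -> W) (x v : V) (d d' : W) :
  is_derive x v f d -> is_derive x v f d' -> d = d'.
Proof. by move=> [_ <-] [_ <-]. Qed.

Lemma row_mx_differentiable (V : normedModType R) (n1 n2 : nat)
    (f : V -> 'rV[R]_n1) (g : V -> 'rV[R]_n2) (x : V) :
  differentiable f x -> differentiable g x ->
  differentiable (fun y => row_mx (f y) (g y)) x.
Proof.
move=> df dg.
have -> : (fun y => row_mx (f y) (g y)) =
  ((fun v => row_mx v 0) \o f) + ((fun v => row_mx 0 v) \o g).
  by apply/funext => y; rewrite !fctE /= add_row_mx addr0 add0r.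
apply: differentiableD; apply: differentiable_comp => //;
 apply: rV_linear_differentiable => a u v;
 by rewrite scale_row_mx add_row_mx scaler0 addr0.
Qed.

Lemma is_derive_mx (m n : nat) (f : R -> 'M[R]_(m, n)) (t : R) (D : 'M[R]_(m, n)) :
  (forall i j, is_derive t (1 : R) (fun s => f s i j) (D i j)) ->
  is_derive t (1 : R) f D.
Proof.
move=> dD; have df : derivable f t 1.
  by apply/derivable_mxP => i j; have [] := dD i j.
apply: DeriveDef => //; rewrite (derive_mx df).
by apply/matrixP => i j; rewrite mxE; have [] := dD i j.
Qed.

Lemma scale_differentiable (V : normedModType R) (n : nat)
    (a : V -> R) (f : V -> 'rV[R]_n) (x : V) :
  differentiable a x -> differentiable f x ->
  differentiable (fun y => a y *: f y) x.
Proof.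
move=> da df.
have -> : (fun y => a y *: f y) =
    \sum_j (fun y => (a * (fun y => f y 0 j)) y *: (delta_mx 0 j : 'rV[R]_n)).
  apply/funext => y; rewrite [in LHS](row_sum_delta (f y)) scaler_sumr fct_sumE.
  by apply: eq_bigr => j _; rewrite scalerA.
apply: differentiable_sum => j; apply/differentiableZl/differentiableM => //.
apply: (differentiable_comp (g := fun M : 'rV[R]_n => M 0 j)) => //.
exact: differentiable_coord.
Qed.

(** The map B is differentiable on the product as a sum of products of linear
    maps; its partial derivatives are B itself, by linearity in each variable. *)
Lemma is_derive_bilinear (n : nat) (B : 'rV[R]_n -> 'rV[R]_n -> 'rV[R]_n)
    (a b : R -> 'rV[R]_n) (t : R) (u w : 'rV[R]_n) :
  (forall y, linear (B ^~ y)) -> (forall x, linear (B x)) ->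
  is_derive t (1 : R) a u -> is_derive t (1 : R) b w ->
  is_derive t (1 : R) (fun s => B (a s) (b s)) (B u (b t) + B (a t) w).
Proof.
move=> Bl Br da db; pose f (p : 'rV[R]_n * 'rV[R]_n) := B p.1 p.2.
have df (p : 'rV[R]_n * 'rV[R]_n) : differentiable f p.
  have -> : f = \sum_j (fun q : 'rV[R]_n * 'rV[R]_n =>
      q.1 0 j *: B (delta_mx 0 j) q.2).
    apply/funext => q; rewrite fct_sumE /f [X in B X _ = _](row_sum_delta q.1).
    pose L := HB.pack_for {linear 'rV[R]_n -> 'rV[R]_n} (B ^~ q.2)
      (GRing.isLinear.Build _ _ _ _ _ (Bl q.2)).
    by rewrite -[LHS]/(L _) linear_sum; apply: eq_bigr => j _; rewrite linearZ.
  have [dfst _] := linear_diffE (f := fun q : 'rV[R]_n * 'rV[R]_n => q.1) p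
    (fun _ _ _ => erefl) (fun q => cvg_fst).
  have [dsnd _] := linear_diffE (f := fun q : 'rV[R]_n * 'rV[R]_n => q.2) p
    (fun _ _ _ => erefl) (fun q => cvg_snd).
  apply: differentiable_sum => j; apply: scale_differentiable.
    apply: (differentiable_comp (g := fun M : 'rV[R]_n => M 0 j) dfst).
    exact: differentiable_coord.
  apply: (differentiable_comp (g := B (delta_mx 0 j)) dsnd).
  exact: rV_linear_differentiable.
have := is_derive_comp_diff (is_derive_pair da db) (df (a t, b t)).
have -> : ((u, w) : 'rV[R]_n * 'rV[R]_n) = (u, 0) + (0, w).
  by congr (_, _); rewrite /= ?addr0 ?add0r.
rewrite linearD -!(deriveE _ (df _)).
suff [-> ->] : 'D_(u, 0) f (a t, b t) = B u (b t) /\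
  'D_(0, w) f (a t, b t) = B (a t) w by [].
have [d1 d1E] := linear_diffE (a t) (Bl (b t)) (rV_linear_continuous (Bl (b t))).
have [d2 d2E] := linear_diffE (b t) (Br (a t)) (rV_linear_continuous (Br (a t))).
split.
  transitivity ('D_u (B ^~ (b t)) (a t)); last by rewrite (deriveE _ d1) d1E.
  rewrite /derive; set F := (X in X @ _); set G := (X in _ = lim (X @ _)).
  by suff -> : F = G by []; apply/funext => s; rewrite /F /G /f /= scaler0 add0r.
transitivity ('D_w (B (a t)) (b t)); last by rewrite (deriveE _ d2) d2E.
rewrite /derive; set F := (X in X @ _); set G := (X in _ = lim (X @ _)).
by suff -> : F = G by []; apply/funext => s; rewrite /F /G /f /= scaler0 add0r.
Qed.

End Differentials.

(** * The adjoint representation of a Lie group read in a chart *)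

Section Charts.
Variables (R : realType) (n : nat) (U : lieGroupType R n).
Implicit Types (a b c : chart R n U) (g h x : U).

Lemma cimgP a p : cimg a p -> cdom a (cinv a p) /\ cmap a (cinv a p) = p.
Proof. by move=> [x ax <-]; rewrite cmapK. Qed.

Lemma near_cimg a x : cdom a x -> \forall p \near cmap a x, cimg a p.
Proof. by move=> ax; apply: open_nbhs_nbhs; split; [exact: cimg_open|exists x]. Qed.

Lemma near_cinv a x (A : set U) :
  cdom a x -> nbhs x A -> \forall p \near cmap a x, A (cinv a p).
Proof.
by move=> ax xA; apply: (cinv_continuous ax); rewrite /= cmapK.
Qed.

Lemma nbhs_cdom a x : cdom a x -> nbhs x (cdom a).
Proof. by move=> ax; apply: open_nbhs_nbhs; split => //; exact: cdom_open. Qed.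

Lemma mul_cvg (T : Type) (F : set_system T) (FF : Filter F) (f g : T -> U) x y :
  f @ F --> x -> g @ F --> y -> (fun t => f t * g t)%g @ F --> (x * y)%g.
Proof.
move=> fx gy; apply: (@cvg_comp _ _ _ (fun t => (f t, g t))
  (fun p : U * U => (p.1 * p.2)%g) F (nbhs (x, y))).
  exact: cvg_pair.
exact: (@lie_mul_continuous R n U (x, y)).
Qed.

Lemma translation_continuous g h : continuous (fun x : U => (g * x * h)%g).
Proof.
move=> x; apply: mul_cvg; last exact: cvg_cst.
by apply: mul_cvg; [exact: cvg_cst|exact: cvg_id].
Qed.

Lemma lmul_differentiable a b g x : atlas a -> atlas b ->
  cdom a x -> cdom b (g * x)%g ->
  differentiable (fun p => cmap b (g * cinv a p)%g) (cmap a x).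
Proof.
move=> ha hb ax bgx; have [c hc cg] := atlas_cover g.
have [/= mul_diff _] := lie_mul_smooth _ _ _ hc ha hb 1.
have : differentiable (fun p => row_mx (cmap c g) p : 'rV[R]_(n + n)) (cmap a x).
  by apply: row_mx_differentiable; exact: ex_diff.
move=> /differentiable_comp /(_ (mul_diff _ _)); rewrite /comp /=.
under eq_fun do rewrite row_mxKl row_mxKr cmapK //.
by apply; split; rewrite ?row_mxKl ?row_mxKr ?cmapK//; [exists g|exists x].
Qed.

Lemma rmul_differentiable a b g x : atlas a -> atlas b ->
  cdom a x -> cdom b (x * g)%g ->
  differentiable (fun p => cmap b (cinv a p * g)%g) (cmap a x).
Proof.
move=> ha hb ax bgx; have [c hc cg] := atlas_cover g.
have [/= mul_diff _] := lie_mul_smooth _ _ _ ha hc hb 1.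
have : differentiable (fun p => row_mx p (cmap c g) : 'rV[R]_(n + n)) (cmap a x).
  by apply: row_mx_differentiable; exact: ex_diff.
move=> /differentiable_comp /(_ (mul_diff _ _)); rewrite /comp /=.
under eq_fun do rewrite row_mxKl row_mxKr cmapK //.
by apply; split; rewrite ?row_mxKl ?row_mxKr ?cmapK//; [exists x|exists g].
Qed.

(** Smoothness of the multiplication is known only in charts, and g, x, h, gx and
    gxh may lie in different ones; a left and a right translation are composed
    through a chart at gx. *)
Lemma translation_differentiable a b g h x : atlas a -> atlas b ->
  cdom a x -> cdom b (g * x * h)%g ->
  differentiable (fun p => cmap b (g * cinv a p * h)%g) (cmap a x).
Proof.
move=> ha hb ax bx; have [c hc cgx] := atlas_cover (g * x)%g.
have dl := lmul_differentiable ha hc ax cgx.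
have dr := rmul_differentiable hc hb cgx bx.
apply: near_differentiable; last first.
  apply: (differentiable_comp dl (g := fun q => cmap b (cinv c q * h)%g)).
  by rewrite cmapK.
rewrite /=; apply: (@near_cinv a x (fun y =>
  cmap b (cinv c (cmap c (g * y)) * h)%g = cmap b (g * y * h)%g)) => //.
have : \forall y \near x, cdom c (g * y)%g.
  have : (fun y => g * y)%g @ x --> (g * x)%g.
    by apply: mul_cvg; [exact: cvg_cst|exact: cvg_id].
  by apply; exact: nbhs_cdom.
by apply: filterS => y cy; rewrite cmapK.
Qed.

End Charts.

Section Adjoint.
Variables (R : realType) (n : nat) (U : lieGroupType R n) (phi : chart R n U).
Hypothesis hphi : chart_at_one phi.
Implicit Types (g h x : U) (X Y Z : 'rV[R]_n).

Let phi_atlas : atlas phi := hphi.1.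
Let phi1 : cdom phi 1%g := hphi.2.
Local Notation e := (cmap phi 1%g).

(** Conjugation by g read in the chart; [Ad g] is its differential at e. *)
Let conj g p := cmap phi (g * cinv phi p * g^-1)%g.

Lemma conj_one g : conj g e = e.
Proof. by rewrite /conj cmapK // mulg1 mulgV. Qed.

Lemma conj_differentiable g : differentiable (conj g) e.
Proof.
by apply: translation_differentiable => //; rewrite mulg1 mulgV.
Qed.

Lemma AdE g X : Ad phi g X = 'd (conj g) e X.
Proof. by rewrite /Ad deriveE //; exact: conj_differentiable. Qed.

Lemma Ad_linear g : linear (Ad phi g).
Proof. by move=> a X Y; rewrite !AdE linearP. Qed.

Lemma Ad1 X : Ad phi 1%g X = X.
Proof.
rewrite /Ad -[RHS](derive_id e); apply: near_eq_derive.
apply: filterS (near_cimg phi1) => p /cimgP[_ pK].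
by rewrite mul1g invg1 mulg1 pK.
Qed.

Lemma near_conj g : \forall p \near e, cdom phi (g * cinv phi p * g^-1)%g.
Proof.
apply: (@near_cinv _ _ _ _ _ (fun x => cdom phi (g * x * g^-1)%g)) => //.
by apply: translation_continuous; rewrite mulg1 mulgV; exact: nbhs_cdom.
Qed.

(** The chain rule: conjugation by gh is the composite of the conjugations by h
    and by g, near the point e which both fix. *)
Lemma AdM g h X : Ad phi (g * h)%g X = Ad phi g (Ad phi h X).
Proof.
have dh := conj_differentiable h.
have dg : differentiable (conj g) (conj h e).
  by rewrite conj_one; exact: conj_differentiable.
transitivity ('D_X (conj g \o conj h) e).
  2: by rewrite (derive_comp _ dh dg) conj_one.
apply: near_eq_derive; apply: filterS (near_conj h) => p hp.
by rewrite /= /conj cmapK // invgM !mulgA.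
Qed.

(** Multiplication and inversion read in the chart at the identity, and the open
    set where smoothness of the former is known. *)
Let mul2 (pq : 'rV[R]_(n + n)) :=
  cmap phi (cinv phi (lsubmx pq) * cinv phi (rsubmx pq))%g.
Let inv2 p := cmap phi ((cinv phi p)^-1)%g.
Let dom2 : set 'rV[R]_(n + n) := [set pq | [/\ cimg phi (lsubmx pq),
  cimg phi (rsubmx pq)
  & cdom phi (cinv phi (lsubmx pq) * cinv phi (rsubmx pq))%g]].

Lemma derive_mul2r (p q X : 'rV[R]_n) :
  'D_X (fun q' => mul2 (row_mx p q')) q = 'D_(row_mx 0 X) mul2 (row_mx p q).
Proof.
rewrite /derive; set F := (X in X @ _) ; set G := (X in _ = lim (X @ _)).
suff -> : F = G by [].
apply/funext => t; rewrite /F /G /=.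
by rewrite scale_row_mx scaler0 add_row_mx add0r.
Qed.

Lemma derive_mul2l (p q X : 'rV[R]_n) :
  'D_X (fun p' => mul2 (row_mx p' q)) p = 'D_(row_mx X 0) mul2 (row_mx p q).
Proof.
rewrite /derive; set F := (X in X @ _) ; set G := (X in _ = lim (X @ _)).
suff -> : F = G by [].
apply/funext => t; rewrite /F /G /=.
by rewrite scale_row_mx scaler0 add_row_mx add0r.
Qed.

Lemma mul2_smooth :
  (forall pq : 'rV[R]_(n + n), dom2 pq -> differentiable mul2 pq) /\
  (forall v pq : 'rV[R]_(n + n),
     dom2 pq -> differentiable (fun qp => 'D_v mul2 qp) pq).
Proof.
have [dm dDm] := lie_mul_smooth _ _ _ phi_atlas phi_atlas phi_atlas 2.
by split=> // v; have [] := dDm v.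
Qed.

Lemma mul2_rdiff (p q : 'rV[R]_n) : dom2 (row_mx p q) ->
  differentiable (fun q' => mul2 (row_mx p q')) q.
Proof.
move=> pq; apply: (differentiable_comp (g := mul2)); last exact: mul2_smooth.1.
by apply: row_mx_differentiable; exact: ex_diff.
Qed.

Lemma mul2_ldiff (p q : 'rV[R]_n) : dom2 (row_mx p q) ->
  differentiable (fun p' => mul2 (row_mx p' q)) p.
Proof.
move=> pq; apply: (differentiable_comp (g := mul2) (f := fun p' => row_mx p' q));
  last exact: mul2_smooth.1.
by apply: row_mx_differentiable; exact: ex_diff.
Qed.

(** Conjugation by p is q |-> (p q) p^-1.  By the chain rule its differential in
    the direction X at e is the partial derivative of the multiplication at
    (p, p^-1) in its first variable, applied to its partial derivative at (p, e)
    in its second variable.  Expanding over the basis leaves only derivatives in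
    fixed directions, which are differentiable functions of p. *)
Lemma Ad_cinvE p X : cimg phi p -> dom2 (row_mx p e) ->
  cdom phi ((cinv phi p)^-1)%g ->
  Ad phi (cinv phi p) X = \sum_j (('D_(row_mx 0 X) mul2 (row_mx p e)) 0 j *:
    'D_(row_mx (delta_mx 0 j) 0) mul2 (row_mx p (inv2 p))).
Proof.
move=> /[dup] img_p /cimgP[dp pK] d1 dpV.
have d2 : dom2 (row_mx p (inv2 p)).
  split; rewrite /inv2 ?row_mxKl ?row_mxKr //; first by exists ((cinv phi p)^-1)%g.
  by rewrite cmapK // mulgV.
pose mu q := mul2 (row_mx p q); pose nu r := mul2 (row_mx r (inv2 p)).
have mue : mu e = p.
  by rewrite /mu /mul2 row_mxKl row_mxKr cmapK // mulg1 pK.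
have dmu : differentiable mu e by exact: mul2_rdiff.
have dnu : differentiable nu (mu e) by rewrite mue; exact: mul2_ldiff.
transitivity ('D_X (nu \o mu) e).
  apply: near_eq_derive.
  have near1 : nbhs (1%g : U) [set x | cdom phi (cinv phi p * x)%g].
    have : (fun x => cinv phi p * x)%g @ (1%g : U) --> (cinv phi p * 1)%g.
      by apply: mul_cvg; [exact: cvg_cst|exact: cvg_id].
    by apply; rewrite mulg1; exact: nbhs_cdom.
  apply: filterS (near_cinv phi1 near1) => q /= dpq.
  rewrite /nu /mu /mul2 !row_mxKl !row_mxKr [cinv phi (inv2 p)]cmapK //.
  by rewrite [cinv phi (cmap phi (_ * _)%g)]cmapK.
set w := 'D_(row_mx 0 X) mul2 (row_mx p e).
have dmuE : 'D_X mu e = w by exact: derive_mul2r.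
rewrite (derive_comp _ dmu dnu) dmuE mue derive_mul2l.
have dm := mul2_smooth.1 _ d2.
rewrite (deriveE _ dm) {1}[w]row_sum_delta.
have rowl : linear (fun v : 'rV[R]_n => row_mx v 0 : 'rV[R]_(n + n)).
  by move=> a u v; rewrite scale_row_mx add_row_mx scaler0 addr0.
pose rl : {linear 'rV[R]_n -> 'rV[R]_(n + n)} :=
  HB.pack (fun v : 'rV[R]_n => row_mx v 0 : 'rV[R]_(n + n))
    (GRing.isLinear.Build _ _ _ _ _ rowl).
rewrite -[row_mx _ 0]/(rl _) !linear_sum; apply: eq_bigr => j _.
by rewrite !linearZ (deriveE _ dm).
Qed.

(** This is where the multiplication has to be of class C^2: one derivative is
    taken to form Ad and a second one to form the bracket. *)
Lemma Ad_cinv_differentiable X :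
  differentiable (fun p => Ad phi (cinv phi p) X) e.
Proof.
have nearV : nbhs (1%g : U) [set x | cdom phi (x^-1)%g].
  have := @lie_inv_continuous R n U 1%g.
  by apply; rewrite invg1; exact: nbhs_cdom.
have img_e : cimg phi e by exists 1%g.
have d1 (p : 'rV[R]_n) : cimg phi p -> dom2 (row_mx p e).
  move=> /[dup] img_p /cimgP[dp _].
  by split; rewrite ?row_mxKl ?row_mxKr // cmapK // mulg1.
have inv_e : inv2 e = e by rewrite /inv2 cmapK // invg1.
have d2 : dom2 (row_mx e (inv2 e)) by rewrite inv_e; exact: d1.
have [dm dDm] := mul2_smooth.
have dinv : differentiable inv2 e.
  have [/= inv_diff _] := lie_inv_smooth _ _ phi_atlas phi_atlas 1.
  by apply: inv_diff; split => //=; rewrite cmapK // invg1.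
apply: (@near_differentiable _ _ _ (fun p => \sum_j
   (('D_(row_mx 0 X) mul2 (row_mx p e)) 0 j *:
    'D_(row_mx (delta_mx 0 j) 0) mul2 (row_mx p (inv2 p))))).
  apply: filterS2 (near_cimg phi1) (near_cinv phi1 nearV) => p img_p Vp.
  by rewrite Ad_cinvE //; exact: d1.
rewrite -fct_sumE; apply: differentiable_sum => j; apply: scale_differentiable.
  apply: (differentiable_comp (g := fun M : 'rV[R]_n => M 0 j)
     (f := fun p => 'D_(row_mx 0 X) mul2 (row_mx p e)));
    last exact: differentiable_coord.
  apply: (differentiable_comp (f := fun p => row_mx p e)
     (g := fun qp => 'D_(row_mx 0 X) mul2 qp)).
    by apply: row_mx_differentiable; exact: ex_diff.
  by apply: dDm; exact: d1.
apply: (differentiable_comp (f := fun p => row_mx p (inv2 p))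
     (g := fun qp => 'D_(row_mx (delta_mx 0 j) 0) mul2 qp)).
  by apply: row_mx_differentiable => //; exact: ex_diff.
exact: dDm.
Qed.

Lemma bracketE X Y :
  bracket phi X Y = 'd (fun p => Ad phi (cinv phi p) Y) e X.
Proof. by rewrite /bracket deriveE //; exact: Ad_cinv_differentiable. Qed.

Lemma bracket_linearl Y : linear (bracket phi ^~ Y).
Proof. by move=> a X X'; rewrite !bracketE linearP. Qed.

Lemma bracket_linearr X : linear (bracket phi X).
Proof.
move=> a Y Y'; pose F Z p := Ad phi (cinv phi p) Z.
have dF Z : derivable (F Z) e X by exact/diff_derivable/Ad_cinv_differentiable.
have FE : F (a *: Y + Y') = a *: F Y + F Y'.
  by apply/funext => p; exact: Ad_linear.
transitivity ('D_X (a *: F Y + F Y') e); first by rewrite -FE.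
have [_ ->] // : is_derive e X (a *: F Y + F Y') (a *: 'D_X (F Y) e + 'D_X (F Y') e).
apply: is_deriveD; last exact/derivableP.
exact/is_deriveZ/derivableP.
Qed.

(** Both sides are the derivatives at e, in the direction X, of the two members
    of Ad(g) Ad(p) Y = Ad(g p g^-1) Ad(g) Y. *)
Lemma Ad_bracket g X Y :
  Ad phi g (bracket phi X Y) = bracket phi (Ad phi g X) (Ad phi g Y).
Proof.
have dY := Ad_cinv_differentiable Y.
have dK := conj_differentiable g.
have dgY : differentiable (fun p => Ad phi (cinv phi p) (Ad phi g Y)) (conj g e).
  by rewrite conj_one; exact: Ad_cinv_differentiable.
have [dA dAE] := linear_diffE (Ad phi (cinv phi e) Y) (Ad_linear g)
  (rV_linear_continuous (Ad_linear g)).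
have := derive_comp X dK dgY; rewrite [in X in _ = X]conj_one.
rewrite -[X in _ = X -> _]/(bracket phi (Ad phi g X) (Ad phi g Y)) => <-.
transitivity ('D_(bracket phi X Y) (Ad phi g) (Ad phi (cinv phi e) Y)).
  by rewrite (deriveE _ dA) dAE.
rewrite -(derive_comp X dY dA).
apply: near_eq_derive.
apply: filterS2 (near_cimg phi1) (near_conj g) => p img_p dp.
rewrite -[LHS]AdM -[RHS]/(Ad phi (cinv phi (conj g p)) (Ad phi g Y)) -[RHS]AdM.
by rewrite [cinv phi (conj g p)]cmapK // mulgVK.
Qed.

Lemma is_derive_Ad X Y : is_derive (0 : R) (1 : R)
  (fun t : R => Ad phi (cinv phi (e + t *: X)) Y) (bracket phi X Y).
Proof.
rewrite bracketE.
have dY := Ad_cinv_differentiable Y.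
have := is_derive_comp_diff (is_derive_line e X) (f := fun p => Ad phi (cinv phi p) Y).
by rewrite /= scale0r addr0; exact.
Qed.

End Adjoint.

(** * The Lie algebra of an adjoint representation *)

Lemma mul_rV_lin1_linear (R : comNzRingType) (m n : nat) (f : 'rV[R]_m -> 'rV[R]_n)
    (v : 'rV[R]_m) : linear f -> v *m lin1_mx f = f v.
Proof.
move=> lf; pose fL : {linear 'rV[R]_m -> 'rV[R]_n} :=
  HB.pack f (GRing.isLinear.Build _ _ _ _ _ lf).
exact: (mul_rV_lin1 fL).
Qed.

Definition killing_form (F : comNzRingType) (n : nat)
    (br : 'rV[F]_n -> 'rV[F]_n -> 'rV[F]_n) (X Y : 'rV[F]_n) : F :=
  \tr (lin1_mx (fun Z => br X (br Y Z))).

(** The part of the structure of a compact semisimple Lie group that the geometry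
    of its adjoint orbits depends on.  The curve [flow X] goes through the identity
    at time 0, with velocity X in the sense of [is_derive_Adj], which is what links
    the bracket to the group. *)
Record adjoint_rep (R : realType) (n : nat) (G : groupType) := AdjointRep {
  Adj : G -> 'rV[R]_n -> 'rV[R]_n;
  brk : 'rV[R]_n -> 'rV[R]_n -> 'rV[R]_n;
  flow : 'rV[R]_n -> R -> G;
  Adj_linear : forall g, linear (Adj g);
  Adj1 : forall X, Adj 1%g X = X;
  AdjM : forall g h X, Adj (g * h)%g X = Adj g (Adj h X);
  brk_linearl : forall Y, linear (brk ^~ Y);
  brk_linearr : forall X, linear (brk X);
  Adj_brk : forall g X Y, Adj g (brk X Y) = brk (Adj g X) (Adj g Y);
  flow0 : forall X, flow X 0 = 1%g;
  is_derive_Adj : forall X Y,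
    is_derive (0 : R) (1 : R) (fun t : R => Adj (flow X t) Y) (brk X Y);
  Adj_bounded : forall Y, exists M : R, forall g, `|Adj g Y| <= M;
  killing_nondegenerate : forall X, (forall Y, killing_form brk X Y = 0) -> X = 0
}.

Section LieAlgebra.
Variables (R : realType) (n : nat) (G : groupType) (A : adjoint_rep R n G).
Implicit Types (g h : G) (X Y Z v : 'rV[R]_n).
Local Notation "⟪ X , Y ⟫" := (brk A X Y).
Local Notation Ad := (Adj A).
Local Notation killing := (killing_form (brk A)).

HB.instance Definition _ g := GRing.isLinear.Build _ _ _ _ (Ad g) (Adj_linear A g).

Lemma AdjK g X : Ad (g^-1)%g (Ad g X) = X.
Proof. by rewrite -AdjM mulVg Adj1. Qed.

Lemma AdjVK g X : Ad g (Ad (g^-1)%g X) = X.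
Proof. by rewrite -AdjM mulgV Adj1. Qed.

Lemma brkDl X X' Y : ⟪X + X', Y⟫ = ⟪X, Y⟫ + ⟪X', Y⟫.
Proof. by have := brk_linearl A Y 1 X X'; rewrite !scale1r. Qed.

Lemma brkDr X Y Y' : ⟪X, Y + Y'⟫ = ⟪X, Y⟫ + ⟪X, Y'⟫.
Proof. by have := brk_linearr A X 1 Y Y'; rewrite !scale1r. Qed.

Lemma brk0l Y : ⟪0, Y⟫ = 0.
Proof. by apply: (addrI ⟪0, Y⟫); rewrite -brkDl !addr0. Qed.

Lemma brk0r X : ⟪X, 0⟫ = 0.
Proof. by apply: (addrI ⟪X, 0⟫); rewrite -brkDr !addr0. Qed.

Lemma brkNl X Y : ⟪- X, Y⟫ = - ⟪X, Y⟫.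
Proof. by apply: (addrI ⟪X, Y⟫); rewrite -brkDl !subrr brk0l. Qed.

Lemma brkNr X Y : ⟪X, - Y⟫ = - ⟪X, Y⟫.
Proof. by apply: (addrI ⟪X, Y⟫); rewrite -brkDr !subrr brk0r. Qed.

(** The derivative at the identity of Ad(g) [X, Y] = [Ad(g) X, Ad(g) Y] in the
    direction Z. *)
Lemma brk_leibniz Z X Y : ⟪Z, ⟪X, Y⟫⟫ = ⟪ ⟪Z, X⟫, Y⟫ + ⟪X, ⟪Z, Y⟫⟫.
Proof.
have dXY := is_derive_Adj A Z ⟪X, Y⟫.
have := is_derive_bilinear (brk_linearl A) (brk_linearr A)
  (is_derive_Adj A Z X) (is_derive_Adj A Z Y).
rewrite flow0 !Adj1 => dd.
apply: is_derive_unique dXY _.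
have -> // : (fun t => Ad (flow A Z t) ⟪X, Y⟫) =
  (fun t => ⟪Ad (flow A Z t) X, Ad (flow A Z t) Y⟫).
by apply/funext => t; rewrite Adj_brk.
Qed.

(** Vectors are rows and matrices act on the right, so that products come in the
    order opposite to that of the composition of operators. *)
Definition ad X : 'M[R]_n := lin1_mx (brk A X).
Definition Admx g : 'M[R]_n := lin1_mx (Ad g).

Lemma mul_ad X v : v *m ad X = ⟪X, v⟫.
Proof. exact/mul_rV_lin1_linear/brk_linearr. Qed.

Lemma mul_Admx g v : v *m Admx g = Ad g v.
Proof. exact/mul_rV_lin1_linear/Adj_linear. Qed.

Lemma mx_rV_ext (B C : 'M[R]_n) : (forall v : 'rV_n, v *m B = v *m C) -> B = C.
Proof. by move=> BC; apply/row_matrixP => i; rewrite !rowE BC. Qed.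

Lemma ad_linear : linear ad.
Proof.
move=> a X Y; apply: mx_rV_ext => v.
by rewrite mulmxDr -scalemxAr !mul_ad; exact: brk_linearl.
Qed.

HB.instance Definition _ := GRing.isLinear.Build _ _ _ _ ad ad_linear.

Lemma ad_brk X Y : ad ⟪X, Y⟫ = ad Y *m ad X - ad X *m ad Y.
Proof.
apply: mx_rV_ext => v; rewrite mulmxBr !mulmxA !mul_ad.
by rewrite (brk_leibniz X Y v) addrK.
Qed.

Lemma AdmxM g h : Admx (g * h)%g = Admx h *m Admx g.
Proof. by apply: mx_rV_ext => v; rewrite mulmxA !mul_Admx AdjM. Qed.

Lemma Admx1 : Admx 1%g = 1%:M.
Proof. by apply: mx_rV_ext => v; rewrite mul_Admx Adj1 mulmx1. Qed.

Lemma AdmxV g : Admx g *m Admx (g^-1)%g = 1%:M.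
Proof. by rewrite -AdmxM mulVg Admx1. Qed.

Lemma ad_Adj g X : ad (Ad g X) = Admx (g^-1)%g *m ad X *m Admx g.
Proof.
apply: mx_rV_ext => v; rewrite !mulmxA mul_Admx !mul_ad mul_Admx.
by rewrite Adj_brk AdjVK.
Qed.

Lemma killingE X Y : killing X Y = \tr (ad Y *m ad X).
Proof.
rewrite /killing_form; congr (\tr _); apply: mx_rV_ext => v.
rewrite mulmxA !mul_ad mul_rV_lin1_linear // => a Z Z'.
by rewrite !brk_linearr.
Qed.

Lemma killingC X Y : killing X Y = killing Y X.
Proof. by rewrite !killingE mxtrace_mulC. Qed.

Lemma killing_linearr X : linear (killing X).
Proof. by move=> a Y Z; rewrite !killingE linearP mulmxDl -scalemxAl linearP. Qed.

HB.instance Definition _ X :=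
  GRing.isLinear.Build _ _ _ _ (killing X) (killing_linearr X).

Lemma killing_Adj g X Y : killing (Ad g X) (Ad g Y) = killing X Y.
Proof.
rewrite !killingE !ad_Adj -!mulmxA (mulmxA (Admx g)) AdmxV mul1mx.
by rewrite mxtrace_mulC -!mulmxA AdmxV mulmx1.
Qed.

(** Invariance of the Killing form, from the cyclicity of the trace. *)
Lemma killing_brk Z X Y : killing X ⟪Z, Y⟫ = - killing ⟪Z, X⟫ Y.
Proof.
rewrite !killingE !ad_brk mulmxBl mulmxBr !raddfB /= !mulmxA.
by rewrite (mxtrace_mulC (ad Y *m ad X)) !mulmxA opprK addrC.
Qed.

Lemma ad_eq0 X : ad X = 0 -> X = 0.
Proof.
move=> adX; apply: (killing_nondegenerate (a := A)) => Y.
by rewrite killingE adX mulmx0 mxtrace0.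
Qed.

(** The Leibniz rule for (X, X, Y) reads [[X, X], Y] = 0.  Thus [X, X] acts
    trivially, and it vanishes since the Killing form is nondegenerate. *)
Lemma brkxx X : ⟪X, X⟫ = 0.
Proof. by apply: ad_eq0; rewrite ad_brk subrr. Qed.

Lemma brkC X Y : ⟪X, Y⟫ = - ⟪Y, X⟫.
Proof.
apply/eqP; rewrite -addr_eq0; apply/eqP.
by have := brkxx (X + Y); rewrite brkDl !brkDr !brkxx add0r addr0.
Qed.

Lemma brk_center Z : (forall X, ⟪X, Z⟫ = 0) -> Z = 0.
Proof.
move=> ZC; apply: ad_eq0; apply: mx_rV_ext => v.
by rewrite mul_ad brkC ZC oppr0 mulmx0.
Qed.

Lemma killing_brk_eq0 Z : (forall X Y, killing Z ⟪X, Y⟫ = 0) -> Z = 0.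
Proof.
move=> h; apply: brk_center => X.
apply: (killing_nondegenerate (a := A)) => Y.
by apply: oppr_inj; rewrite -killing_brk h oppr0.
Qed.

Definition kks_form x v w :=
  let lift z := xget 0 [set X | ⟪X, x⟫ = z] in killing x ⟪lift v, lift w⟫.

(** The right-hand side depends on X and Y only through [X, x] and [Y, x], by
    invariance of the Killing form, so the choice of the lifts is immaterial. *)
Lemma kks_brk x X Y : kks_form x ⟪X, x⟫ ⟪Y, x⟫ = killing x ⟪X, Y⟫.
Proof.
rewrite /kks_form; set X' := xget _ _; set Y' := xget _ _.
have X'x : ⟪X', x⟫ = ⟪X, x⟫.
  by rewrite /X'; case: xgetP => [? -> //|/(_ X) [] ].
have Y'x : ⟪Y', x⟫ = ⟪Y, x⟫.
  by rewrite /Y'; case: xgetP => [? -> //|/(_ Y) [] ].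
transitivity (killing x ⟪X, Y'⟫); first by rewrite !killing_brk X'x.
by rewrite (brkC X Y') (brkC X Y) !linearN /= !killing_brk Y'x.
Qed.

End LieAlgebra.

(** * Generators of bounded matrix groups are semisimple *)

Lemma mx_entry_le_norm (R : realType) (m n : nat) (B : 'M[R]_(m, n)) i j :
  `|B i j| <= `|B|.
Proof.
by rewrite [leRHS]/Num.Def.normr/= mx_normrE; exact: (le_bigmax _ _ (i, j)).
Qed.

(** How convexity turns a first order estimate into a global one: a decrease from
    N to N' along a segment would show with slope N - N' near its origin, where th
    is small. *)
Lemma convex_gap (R : realFieldType) (th N N' q : R) :
  0 < th -> N <= (1 - th) * N + th * N' + th * q -> N - N' <= q.
Proof. by move=> th0 le_N; rewrite -(ler_pM2l th0); lra. Qed.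

Section OrbitNorm.
Import complex.
Variables (R : realType) (m : nat).
Local Notation C := (complex R).
Local Notation toC := (map_mx (real_complex R)).
Local Notation normc := (@Normc.normc R).
Implicit Types (z w : 'rV[C]_m) (B : 'M[R]_m).

Lemma normc_ge0 (a : C) : 0 <= normc a.
Proof. by case: a => a b; exact: sqrtr_ge0. Qed.

Lemma normc_real (a : R) : normc (real_complex R a) = `|a|.
Proof. by rewrite /= expr0n addr0 sqrtr_sqr. Qed.

Lemma normc_sum (I : finType) (F : I -> C) :
  normc (\sum_i F i) <= \sum_i normc (F i).
Proof.
elim/big_ind2 : _ => [|a x b y ax yb|//]; first by rewrite Normc.normc0.
exact: le_trans (le_normcD _ _) (lerD _ _).
Qed.

Definition sum_normc z : R := \sum_j normc (z 0 j).

Lemma sum_normcD z w : sum_normc (z + w) <= sum_normc z + sum_normc w.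
Proof.
by rewrite -big_split; apply: ler_sum => j _; rewrite mxE; exact: le_normcD.
Qed.

Lemma sum_normcZ (a : C) z : sum_normc (a *: z) = normc a * sum_normc z.
Proof. by rewrite mulr_sumr; apply: eq_bigr => j _; rewrite mxE Normc.normcM. Qed.

Lemma sum_normc_ge0 z : 0 <= sum_normc z.
Proof. by apply: sumr_ge0 => j _; exact: normc_ge0. Qed.

Lemma sum_normc_eq0 z : sum_normc z = 0 -> z = 0.
Proof.
move=> /psumr_eq0P z0; apply/rowP => j; rewrite mxE; apply: Normc.eq0_normc.
by apply: z0 => // i _; exact: normc_ge0.
Qed.

Lemma sum_normc_mul z B (e : R) : (forall i j, `|B i j| <= e) ->
  sum_normc (z *m toC B) <= m%:R * e * sum_normc z.
Proof.
move=> Be; have -> : m%:R * e * sum_normc z = \sum_(j < m) sum_normc z * e.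
  by rewrite sumr_const card_ord -[RHS]mulr_natl; ring.
apply: ler_sum => j _; rewrite mxE (le_trans (normc_sum _)) // mulr_suml.
apply: ler_sum => i _; rewrite mxE Normc.normcM normc_real.
by rewrite ler_wpM2l // normc_ge0.
Qed.

Variables (S : set 'M[R]_m) (M : R).
Hypothesis S1 : S 1%:M.
Hypothesis SM : forall B B', S B -> S B' -> S (B *m B').
Hypothesis SV : forall B, S B -> exists2 B', S B' & B *m B' = 1%:M.
Hypothesis S_bounded : forall B i j, S B -> `|B i j| <= M.

(** Making a norm invariant under a bounded group.  Complex vectors are needed in
    order to deal with the non-real eigenvalues of real matrices. *)
Definition orbit_norm z : R := sup [set sum_normc (z *m toC B) | B in S].

Lemma orbit_norm_ubound z :
  ubound [set sum_normc (z *m toC B) | B in S] (m%:R * M * sum_normc z).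
Proof. by move=> _ [B SB <-]; apply: sum_normc_mul => i j; exact: S_bounded. Qed.

Lemma orbit_norm_ge z B : S B -> sum_normc (z *m toC B) <= orbit_norm z.
Proof.
move=> SB; apply: ub_le_sup; last by exists B.
by exists (m%:R * M * sum_normc z); exact: orbit_norm_ubound.
Qed.

Lemma orbit_norm_le z (e : R) :
  (forall B, S B -> sum_normc (z *m toC B) <= e) -> orbit_norm z <= e.
Proof.
move=> ze; apply: ge_sup; first by exists (sum_normc (z *m toC 1%:M)), 1%:M.
by move=> _ [B SB <-]; exact: ze.
Qed.

Lemma orbit_normD z w : orbit_norm (z + w) <= orbit_norm z + orbit_norm w.
Proof.
apply: orbit_norm_le => B SB; rewrite mulmxDl (le_trans (sum_normcD _ _)) //.
by rewrite lerD // orbit_norm_ge.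
Qed.

Lemma orbit_norm_ge0 z : 0 <= orbit_norm z.
Proof. exact: le_trans (sum_normc_ge0 _) (orbit_norm_ge z S1). Qed.

Lemma orbit_normZ_le (a : C) z : orbit_norm (a *: z) <= normc a * orbit_norm z.
Proof.
apply: orbit_norm_le => B SB; rewrite -scalemxAl sum_normcZ.
by rewrite ler_wpM2l ?normc_ge0 // orbit_norm_ge.
Qed.

Lemma orbit_normZ (a : C) z : orbit_norm (a *: z) = normc a * orbit_norm z.
Proof.
have [-> | a0] := eqVneq a 0.
  apply/eqP; rewrite eq_le orbit_normZ_le Normc.normc0 mul0r.
  exact: orbit_norm_ge0.
have na0 : 0 < normc a.
  rewrite lt_def normc_ge0 andbT; apply: contra a0 => /eqP.
  by move=> /Normc.eq0_normc ->.
apply/eqP; rewrite eq_le orbit_normZ_le /= mulrC -ler_pdivlMr //.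
rewrite mulrC -Normc.normcV.
by have := orbit_normZ_le a^-1 (a *: z); rewrite scalerA mulVf // scale1r.
Qed.

Lemma orbit_norm_gt0 z : z != 0 -> 0 < orbit_norm z.
Proof.
move=> z0; apply: lt_le_trans (orbit_norm_ge z S1).
rewrite map_scalar_mx rmorph1 mulmx1 lt_def sum_normc_ge0 andbT.
by apply: contra z0 => /eqP /sum_normc_eq0 ->.
Qed.

Lemma orbit_norm_le_sum z : orbit_norm z <= m%:R * M * sum_normc z.
Proof. by apply: orbit_norm_le => B SB; apply: orbit_norm_ubound; exists B. Qed.

Lemma orbit_norm_invariant z B : S B -> orbit_norm z <= orbit_norm (z *m toC B).
Proof.
move=> SB; have [B' SB' BB'] := SV SB; apply: orbit_norm_le => D SD.
have -> : z *m toC D = z *m toC B *m toC (B' *m D).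
  by rewrite -mulmxA -map_mxM mulmxA BB' mul1mx.
exact/orbit_norm_ge/SM.
Qed.

Lemma derivative_error (c : R -> 'M[R]_m) (A : 'M[R]_m) (e : R) :
  c 0 = 1%:M -> is_derive (0 : R) (1 : R) c A -> 0 < e ->
  exists2 d, 0 < d & forall t, t != 0 -> `|t| < d ->
    exists2 E, c t = 1%:M + t *: (A + E) & forall i j, `|E i j| <= e.
Proof.
move=> c0 [dc dcA] e0.
have /cvgrPdist_le :
    h^-1 *: ((c \o shift 0) (h *: (1 : R)) - c 0) @[h --> 0^'] --> A.
  by rewrite -dcA; exact: dc.
move=> /(_ e e0) [d /= d0 H]; exists d => // t t0 td.
exists (t^-1 *: (c t - 1%:M) - A).
  by rewrite addrCA subrr addr0 scalerA divff // scale1r addrCA subrr addr0.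
move=> i j; apply: le_trans (mx_entry_le_norm _ _ _) _.
have := H t; rewrite /= sub0r normrN => /(_ td t0).
by rewrite distrC addr0 c0 [t *: 1]mulr1.
Qed.

Hypothesis M0 : 0 <= M.
Variables (c : R -> 'M[R]_m) (A : 'M[R]_m).
Hypothesis cS : forall t, S (c t).
Hypothesis c0 : c 0 = 1%:M.
Hypothesis dcA : is_derive (0 : R) (1 : R) c A.

(** To first order in t, the vector z + t z (A - ib) is (1 - itb) z c(t).  The norm
    is invariant under c(t) and |1 - itb| >= 1, so the norm decreases by at most
    o(t) when going from z to z + t z (A - ib); by convexity of the norm it does not
    decrease at all, however far one goes in that direction. *)
Lemma orbit_norm_dissipative z (b s : R) :
  orbit_norm z <= orbit_norm
    (z + real_complex R s *: (z *m toC A - Complex 0 b *: z)).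
Proof.
have [-> | s0] := eqVneq s 0; first by rewrite rmorph0 scale0r addr0.
set D := z *m toC A - _; set y := z + _.
rewrite leNgt; apply/negP => lt_y; set d := orbit_norm z - orbit_norm y.
have d_gt0 : 0 < d by rewrite subr_gt0.
pose Q := `|s| * (m%:R * M * (m%:R * sum_normc z)).
have Q0 : 0 <= Q by rewrite !mulr_ge0 // sum_normc_ge0.
(* The remainder at time t is at most |t| Q 2e / |s|; e makes it smaller than the
   supposed decrease d of the norm, scaled by t / s. *)
pose e := Num.min 1 (d / (4 * (Q + 1))).
have e_gt0 : 0 < e by rewrite lt_min ltr01 /= divr_gt0 // mulr_gt0 // ltr_wpDl.
have e_le1 : e <= 1 by rewrite ge_min lexx.
have Qe : Q * (2 * e) < d.
  have : e <= d / (4 * (Q + 1)) by rewrite ge_min lexx orbT.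
  rewrite ler_pdivlMr; last by rewrite mulr_gt0 // ltr_wpDl.
  by nra.
have [r r0 H] := derivative_error c0 dcA e_gt0.
pose r' := Num.min r (e / ((`|b| + 1) * (`|A| + 1))).
have r'0 : 0 < r'.
  by rewrite lt_min r0 /= divr_gt0 // mulr_gt0 // ltr_wpDl.
(* th < 1 is such that th |s| < r'. *)
pose th := r' / (r' + `|s|).
have s_gt0 : 0 < `|s| by rewrite normr_gt0.
have th_gt0 : 0 < th by rewrite divr_gt0 // addr_gt0.
have th_lt1 : th < 1 by rewrite ltr_pdivrMr ?addr_gt0 // mul1r ltrDl.
pose t := th * s.
have t0 : t != 0 by rewrite mulf_neq0 // gt_eqF.
have t_lt : `|t| < r'.
  rewrite normrM gtr0_norm // /th mulrAC ltr_pdivrMr ?addr_gt0 //.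
  by rewrite ltr_pM2l // ltrDr.
have [|E cE Ee] := H t t0; first by rewrite (lt_le_trans t_lt) // ge_min lexx.
pose rho := z *m toC E - Complex 0 (t * b) *: (z *m toC (A + E)).
have split_curve : (1 - Complex 0 (t * b)) *: z *m toC (c t) =
  real_complex R (1 - th) *: z + real_complex R th *: y +
    real_complex R t *: rho.
  have ibE : Complex 0 (t * b) = real_complex R t * Complex 0 b.
    by apply/eqP; rewrite eq_complex /= !mul0r !mulr0 subrr addr0 !eqxx.
  have cE' : toC (c t) = 1%:M + real_complex R t *: (toC A + toC E).
    by rewrite cE map_mxD map_mx1 map_mxZ map_mxD.
  have tE : real_complex R t = real_complex R th * real_complex R s.
    by rewrite -rmorphM.
  have thE : real_complex R (1 - th) = 1 - real_complex R th.
    by rewrite rmorphB rmorph1.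
  rewrite /rho /y /D cE' mulmxDr mulmx1 map_mxD !mulmxDr -!scalemxAr -!scalemxAl.
  rewrite mulmxDr ibE thE tE.
  move: (z *m toC A) (z *m toC E) => u w.
  by apply/rowP => j; rewrite !mxE; ring.
have rho_le : orbit_norm rho <= m%:R * M * (m%:R * sum_normc z) * (2 * e).
  apply: le_trans (orbit_norm_le_sum _) _.
  rewrite -[leRHS]mulrA ler_wpM2l ?mulr_ge0 //.
  rewrite /rho -scaleN1r scalerA (le_trans (sum_normcD _ _)) // sum_normcZ.
  have AE i j : `|(A + E) i j| <= `|A| + 1.
    rewrite mxE (le_trans (ler_normD _ _)) // lerD ?mx_entry_le_norm //.
    exact: le_trans (Ee i j) e_le1.
  have le1 := sum_normc_mul z Ee; have le2 := sum_normc_mul z AE.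
  have tb : normc (-1 * Complex 0 (t * b)) * (`|A| + 1) <= e.
    rewrite mulN1r normcN /= expr0n add0r sqrtr_sqr normrM -mulrA.
    have := ltW t_lt; rewrite le_min => /andP[_].
    rewrite ler_pdivlMr ?mulr_gt0 ?ltr_wpDl //; apply: le_trans.
    by rewrite ler_wpM2l // ler_wpM2r ?addr_ge0 // lerDl.
  have sz0 := sum_normc_ge0 z.
  have := ler_wpM2l (normc_ge0 (-1 * Complex 0 (t * b))) le2.
  have mz0 : 0 <= m%:R * sum_normc z by rewrite mulr_ge0.
  have := ler_wpM2r mz0 tb.
  move: le1.
  move: (normc _) (sum_normc _) (sum_normc _) (sum_normc z) (`|A|) => p q1 q2 q3 q4.
  by nra.
have : orbit_norm z <= (1 - th) * orbit_norm z + th * orbit_norm y +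
   `|t| * (m%:R * M * (m%:R * sum_normc z) * (2 * e)).
  apply: (@le_trans _ _ (orbit_norm ((1 - Complex 0 (t * b)) *: z *m toC (c t)))).
    apply: le_trans (orbit_norm_invariant _ (cS t)).
    rewrite orbit_normZ ler_peMl ?orbit_norm_ge0 //.
    rewrite /= sub0r sqrrN subr0 -[leLHS]sqrtr1 ler_sqrt; last first.
      by rewrite addr_ge0 // sqr_ge0.
    by rewrite expr1n lerDl sqr_ge0.
  rewrite split_curve (le_trans (orbit_normD _ _)) // lerD //.
    rewrite (le_trans (orbit_normD _ _)) // !orbit_normZ !normc_real.
    by rewrite !gtr0_norm // subr_gt0.
  by rewrite orbit_normZ normc_real ler_wpM2l.
have -> : `|t| = th * `|s| by rewrite normrM gtr0_norm.
have -> : th * `|s| * (m%:R * M * (m%:R * sum_normc z) * (2 * e)) = th * (Q * (2 * e)).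
  by rewrite /Q !mulrA.
by move=> /(convex_gap th_gt0); rewrite leNgt Qe.
Qed.

(** Let l = a + ib.  On u the matrix A - ib acts as the scalar a, and moving from u
    to u - (1/a) a u = 0 would decrease the norm: hence a = 0.  Then w - s u is
    moved to w by adding s times its image u under A - ib, so the norm of w - s u
    is at most that of w for all s, which bounds |s| unless u = 0. *)
Lemma bounded_no_jordan_block (l : C) (u w : 'rV[C]_m) :
  u *m toC A = l *: u -> w *m toC A = l *: w + u -> u = 0.
Proof.
move=> uA wA; apply/eqP/negPn/negP => u0; have Nu := orbit_norm_gt0 u0.
case: l uA wA => a b uA wA.
have lE : Complex a b = real_complex R a + Complex 0 b.
  by apply/eqP; rewrite eq_complex /= addr0 add0r !eqxx.
have uD : u *m toC A - Complex 0 b *: u = real_complex R a *: u.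
  by rewrite uA lE scalerDl addrK.
have wD : w *m toC A - Complex 0 b *: w = real_complex R a *: w + u.
  by rewrite wA lE scalerDl addrAC addrK.
have a0 : a = 0.
  apply/eqP/negPn/negP => a0; have := orbit_norm_dissipative u b (- a^-1).
  rewrite uD scalerA -rmorphM mulNr mulVf // rmorphN rmorph1 scaleN1r subrr.
  have -> : 0 = (0 : C) *: u by rewrite scale0r.
  by rewrite orbit_normZ Normc.normc0 mul0r leNgt Nu.
move: uD wD; rewrite {}a0 rmorph0 !scale0r add0r => uD wD.
pose s := (2 * orbit_norm w + 1) / orbit_norm u.
have s0 : 0 <= s by rewrite divr_ge0 ?(ltW Nu) // addr_ge0 // mulr_ge0 // orbit_norm_ge0.
have := orbit_norm_dissipative (w - real_complex R s *: u) b s.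
have -> : (w - real_complex R s *: u) *m toC A -
    Complex 0 b *: (w - real_complex R s *: u) = u.
  rewrite mulmxBl -scalemxAl (subr0_eq uD) -[w *m toC A](subrK (Complex 0 b *: w)) wD.
  move: (real_complex R s) (Complex 0 b) => p q.
  by apply/rowP => j; rewrite !mxE; ring.
rewrite subrK => le_w.
have : orbit_norm (real_complex R s *: u) <= orbit_norm w + orbit_norm w.
  have -> : real_complex R s *: u = w + (-1) *: (w - real_complex R s *: u).
    by rewrite scaleN1r opprB addrC subrK.
  rewrite (le_trans (orbit_normD _ _)) // lerD2l orbit_normZ normcN Normc.normc1.
  by rewrite mul1r.
rewrite orbit_normZ normc_real ger0_norm // /s divfK ?gt_eqF //.
by rewrite leNgt mulr_natl mulr2n ltrDl ltr01.
Qed.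

End OrbitNorm.

Section Semisimplicity.
Import complex.

(** A common root l of q and q' makes q divisible by (X - l)^2.  By minimality of q
    the matrix (q / (X - l))(A) is not zero, and its nonzero rows are eigenvectors at
    the end of Jordan blocks of size two. *)
Lemma bounded_group_separable (R : realType) (n : nat) (S : set 'M[R]_n.+1)
    (M : R) (c : R -> 'M[R]_n.+1) (A : 'M[R]_n.+1) :
  S 1%:M -> (forall B B', S B -> S B' -> S (B *m B')) ->
  (forall B, S B -> exists2 B', S B' & B *m B' = 1%:M) ->
  0 <= M -> (forall B i j, S B -> `|B i j| <= M) ->
  (forall t, S (c t)) -> c 0 = 1%:M -> is_derive (0 : R) (1 : R) c A ->
  coprimep (mxminpoly A) (mxminpoly A)^`().
Proof.
move=> S1 SM SV M0 SB cS c0 dcA.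
rewrite -(coprimep_map (real_complex R)) -deriv_map -mxminpoly_map.
set AK := map_mx _ A; set q := mxminpoly AK.
apply/Pdiv.ClosedField.coprimepP => l ql; apply/negP => q'l.
have [h qE] := factor_theorem _ _ ql.
have /factor_theorem[k hE] : root h l.
  move: q'l; rewrite qE derivM derivXsubC mulr1 hornerD hornerM hornerXsubC.
  by rewrite subrr mulr0 add0r.
have hA0 : horner_mx AK h != 0.
  apply/negP => /eqP /mxminpoly_min; rewrite -/q => /dvdp_leq.
  have h0 : h != 0.
    apply/negP => /eqP h0; have := mxminpoly_monic AK; rewrite -/q qE h0 mul0r.
    by rewrite monicE lead_coef0 eq_sym oner_eq0.
  by rewrite h0 qE size_Mmonic ?monicXsubC // size_XsubC addn2 /= ltnn => /(_ isT).
have [i /eqP] : exists i, row i (horner_mx AK h) != 0.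
  apply/existsP; rewrite -negb_forall; apply: contra hA0 => /forallP h0.
  by apply/eqP/row_matrixP => i; rewrite row0; exact/eqP/h0.
apply.
have mulXl (p : {poly complex R}) :
    horner_mx AK (p * ('X - l%:P)) = horner_mx AK p *m AK - l *: horner_mx AK p.
  rewrite rmorphM rmorphB /= horner_mx_X horner_mx_C -mulmxE mulmxBr.
  by rewrite mul_mx_scalar.
apply: (bounded_no_jordan_block S1 SM SV SB M0 cS c0 dcA
  (l := l) (w := row i (horner_mx AK k))).
  have := mx_root_minpoly AK; rewrite -/q qE mulXl => /subr0_eq.
  by rewrite -row_mul => ->; rewrite linearZ.
by rewrite -row_mul hE mulXl raddfB /= linearZ /= addrC subrK.
Qed.

End Semisimplicity.

(** * Velocities of curves in an adjoint orbit *)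

Section ConjugacyClass.
Variables (R : realType) (n : nat).
Implicit Types (A B C D P Q : 'M[R]_n.+1) (q : {poly R}).

(** Entrywise, so that the product rule reduces to that of real functions. *)
Definition mx_derive (At : R -> 'M[R]_n.+1) B :=
  forall i j, is_derive (0 : R) (1 : R) (fun t => At t i j) (B i j).

Lemma mx_deriveM (At Bt : R -> 'M[R]_n.+1) A B : mx_derive At A -> mx_derive Bt B ->
  mx_derive (fun t => At t *m Bt t) (A *m Bt 0 + At 0 *m B).
Proof.
move=> dA dB i j.
have -> : (fun t => (At t *m Bt t) i j) =
  \sum_k ((fun t => At t i k) * (fun t => Bt t k j)).
  by apply/funext => t; rewrite mxE fct_sumE.
have -> : (A *m Bt 0 + At 0 *m B) i j =
    \sum_k (At 0 i k *: B k j + Bt 0 k j *: A i k).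
  rewrite !mxE -big_split /=; apply: eq_bigr => k _.
  by rewrite addrC /GRing.scale /= [A i k * _]mulrC.
by apply: is_derive_sum => k; exact: is_deriveM.
Qed.

(** The derivative of q(A(t)) is a sum of terms A^i B A^j; when multiplied by a
    matrix commuting with A, they have the same trace as B A^(i + j), as if A and B
    commuted. *)
Lemma mx_derive_horner (At : R -> 'M[R]_n.+1) B q : mx_derive At B ->
  exists2 D, mx_derive (fun t => horner_mx (At t) q) D &
    forall C, At 0 *m C = C *m At 0 ->
      \tr (D *m C) = \tr (B *m (horner_mx (At 0) q^`() *m C)).
Proof.
move=> dA; elim/poly_ind: q => [|q c [D dD trD]].
  exists 0 => [i j|C _]; last by rewrite deriv0 rmorph0 !mul0mx mulmx0.
  under eq_fun do rewrite rmorph0 mxE.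
  by rewrite mxE; exact: is_derive_cst.
have hE A : horner_mx A (q * 'X + c%:P) = horner_mx A q *m A + c%:M.
  by rewrite rmorphD rmorphM /= horner_mx_X horner_mx_C mulmxE.
exists (D *m At 0 + horner_mx (At 0) q *m B).
  have := mx_deriveM dD dA => dDA i j.
  have -> : (fun t => horner_mx (At t) (q * 'X + c%:P) i j) =
      (fun t => (horner_mx (At t) q *m At t) i j) + cst (c%:M i j).
    by apply/funext => t; rewrite hE mxE.
  by rewrite -[X in is_derive _ _ _ X]addr0; exact: is_deriveD.
move=> C AC; rewrite derivD derivM derivX mulr1 derivC addr0.
rewrite rmorphD rmorphM /= horner_mx_X -mulmxE mulmxDl mxtraceD -mulmxA trD; last first.
  by rewrite {1}AC mulmxA.
rewrite !mulmxDl mulmxDr mxtraceD -!mulmxA; congr (_ + _).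
rewrite mxtrace_mulC -!mulmxA; congr (\tr (_ *m _)).
by apply: comm_mx_horner; exact/esym.
Qed.

Lemma horner_mx_conj P Q A q : P *m Q = 1%:M ->
  horner_mx (Q *m A *m P) q = Q *m horner_mx A q *m P.
Proof.
move=> PQ; have QP := mulmx1C PQ.
elim/poly_ind: q => [|q c IH]; first by rewrite !rmorph0 mulmx0 mul0mx.
rewrite !rmorphD !rmorphM /= !horner_mx_X !horner_mx_C IH -!mulmxE.
rewrite mulmxDr mulmxDl -!mulmxA (mulmxA P) PQ mul1mx; congr (_ + _).
by rewrite mul_scalar_mx -scalemxAr QP scalemx1.
Qed.

(** The minimal polynomial q of A(0) kills the whole curve.  Hence tr(B q'(A) C) = 0
    for all C commuting with A, and q'(A) is invertible in the algebra of
    polynomials in A by a Bezout relation between q and q'. *)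
Lemma conj_curve_trace (At : R -> 'M[R]_n.+1) B C :
  coprimep (mxminpoly (At 0)) (mxminpoly (At 0))^`() ->
  (forall t, exists P Q, P *m Q = 1%:M /\ At t = Q *m At 0 *m P) ->
  mx_derive At B -> At 0 *m C = C *m At 0 -> \tr (B *m C) = 0.
Proof.
set q := mxminpoly _ => cop conjA dA AC.
have [D dD trD] := mx_derive_horner q dA.
have D0 : D = 0.
  apply/matrixP => i j; rewrite mxE; apply: is_derive_unique (dD i j) _.
  suff -> : (fun t => horner_mx (At t) q i j) = cst 0 by exact: is_derive_cst.
  apply/funext => t; have [P [Q [PQ ->]]] := conjA t.
  by rewrite horner_mx_conj // mx_root_minpoly mulmx0 mul0mx mxE.
have /Bezout_coprimepP[[u v] /= /eqpP[[a b] /= /andP[a0 b0] uv]] := cop.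
have : a *: horner_mx (At 0) (v * q^`()) = b%:M.
  have := congr1 (horner_mx (At 0)) uv.
  rewrite !linearZ /= rmorphD [X in _ *: (X + _)]rmorphM /= mx_root_minpoly mulr0 add0r.
  by rewrite rmorph1 -scalemx1.
rewrite mulrC rmorphM /= -mulmxE => vE.
have vC : At 0 *m (horner_mx (At 0) v *m C) = (horner_mx (At 0) v *m C) *m At 0.
  rewrite -mulmxA -AC !mulmxA; congr (_ *m _).
  by apply: comm_mx_horner.
have := trD _ vC; rewrite D0 mul0mx mxtrace0 !mulmxA -(mulmxA B) => /esym tr0.
have : a * \tr (B *m (horner_mx (At 0) q^`() *m horner_mx (At 0) v) *m C) = 0.
  by rewrite tr0 mulr0.
rewrite -mxtraceZ scalemxAl scalemxAr vE mul_mx_scalar -scalemxAl mxtraceZ.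
by move/eqP; rewrite mulf_eq0 (negbTE b0) => /eqP.
Qed.

End ConjugacyClass.

Section AdjointMatrices.
Variables (R : realType) (n : nat) (G : groupType) (A : adjoint_rep R n G).
Local Notation Ad := (Adj A).

Lemma Admx_bounded : exists2 M : R, 0 <= M & forall g i j, `|Admx A g i j| <= M.
Proof.
have /fin_all_exists[M MP] : forall i : 'I_n, exists M : R,
    forall g, `|Ad g (delta_mx 0 i)| <= M by move=> i; exact: Adj_bounded.
have M0 i : 0 <= M i by exact: le_trans (normr_ge0 _) (MP i 1%g).
exists (\sum_i M i) => [|g i j]; first exact: sumr_ge0.
have -> : Admx A g i j = Ad g (delta_mx 0 i) 0 j.
  by rewrite mxE.
apply: le_trans (le_trans (MP i g) _); last first.
  by rewrite (bigD1 i) //= lerDl sumr_ge0.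
exact: mx_entry_le_norm.
Qed.

Lemma is_derive_Admx X (i j : 'I_n) :
  is_derive (0 : R) (1 : R) (fun t => Admx A (flow A X t) i j) (ad A X i j).
Proof.
have lin : linear (fun v : 'rV[R]_n => v 0 j : R^o) by move=> a u v; rewrite !mxE.
have := is_derive_linear lin (rV_linear_continuous lin)
  (is_derive_Adj A X (delta_mx 0 i)).
have -> : ad A X i j = brk A X (delta_mx 0 i) 0 j by rewrite mxE.
have -> // : (fun t => Admx A (flow A X t) i j) =
  (fun t => Ad (flow A X t) (delta_mx 0 i) 0 j).
by apply/funext => t; rewrite mxE.
Qed.

End AdjointMatrices.

Section OrbitTangent.
Variables (R : realType) (G : groupType).

(** The matrices ad(gamma(t)) are conjugate to ad(x), which generates a bounded
    matrix group, and ad(Z) commutes with ad(x) when [Z, x] = 0. *)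
Lemma killing_orbit_velocity (n : nat) (A : adjoint_rep R n G)
    (x v Z : 'rV[R]_n) (gamma : R -> 'rV[R]_n) :
  gamma 0 = x -> (forall t, exists g, gamma t = Adj A g x) ->
  is_derive (0 : R) (1 : R) gamma v ->
  brk A Z x = 0 -> killing_form (brk A) v Z = 0.
Proof.
(* Matrices of size n.+1 form a ring, in which polynomials can be evaluated; in
   dimension zero all traces vanish. *)
case: n A x v Z gamma => [|n] A x v Z gamma g0 gO dg Zx.
  by rewrite killingE [ad A Z]thinmx0 mul0mx mxtrace0.
rewrite killingC killingE.
have [M M0 MP] := Admx_bounded A.
apply: (@conj_curve_trace R n (fun t => ad A (gamma t))).
- rewrite g0; apply: (@bounded_group_separable R n [set Admx A g | g in [set: G] ] M
    (fun t => Admx A (flow A x t))) => //.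
  + by exists 1%g => //; rewrite Admx1.
  + by move=> _ _ [g _ <-] [h _ <-]; exists (h * g)%g => //; rewrite AdmxM.
  + move=> _ [g _ <-]; exists (Admx A (g^-1)%g); last by rewrite AdmxV.
    by exists (g^-1)%g.
  + by move=> _ i j [g _ <-].
  + by rewrite (flow0 A x) Admx1.
  + by apply: is_derive_mx => i j; exact: is_derive_Admx.
- move=> t; have [g ->] := gO t; exists (Admx A g), (Admx A (g^-1)%g).
  by rewrite AdmxV g0 ad_Adj.
- move=> i j.
  have lin : linear (fun X : 'rV[R]_n.+1 => ad A X i j : R^o).
    by move=> a X Y; rewrite ad_linear !mxE.
  exact: (is_derive_linear lin (rV_linear_continuous lin) dg).
- by apply/eqP; rewrite -subr_eq0 g0 -ad_brk Zx linear0.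
Qed.

(** The operator N = [., x] is skew for the Killing form K, so that its image is the
    orthogonal of its kernel, where v lies by [killing_orbit_velocity]. *)
Lemma orbit_velocity (n : nat) (A : adjoint_rep R n G)
    (x v : 'rV[R]_n) (gamma : R -> 'rV[R]_n) :
  gamma 0 = x -> (forall t, exists g, gamma t = Adj A g x) ->
  is_derive (0 : R) (1 : R) gamma v -> exists X, v = brk A X x.
Proof.
move=> g0 gO dg.
have orth Z : brk A Z x = 0 -> killing_form (brk A) v Z = 0.
  exact: killing_orbit_velocity g0 gO dg.
pose K : 'M[R]_n := lin1_mx (fun X => \row_j killing_form (brk A) X (delta_mx 0 j)).
have KE X : X *m K = \row_j killing_form (brk A) X (delta_mx 0 j).
  apply: mul_rV_lin1_linear => a Y Y'; apply/rowP => j; rewrite !mxE.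
  by rewrite killingC killing_linearr !(killingC A (delta_mx 0 j)).
have KT X Y : X *m K *m Y^T = (killing_form (brk A) X Y)%:M.
  rewrite KE [Y in RHS]row_sum_delta linear_sum; apply/matrixP => i j.
  rewrite !ord1 !mxE mulr1n; apply: eq_bigr => k _.
  by rewrite !mxE linearZ mulrC.
have Kfree : row_free K.
  rewrite -kermx_eq0; apply/eqP/row_matrixP => i; rewrite row0.
  apply: (killing_nondegenerate (a := A)) => Y.
  have := KT (row i (kermx K)) Y; rewrite -row_mul mulmx_ker row0 mul0mx.
  by move=> /(congr1 (fun M : 'M[R]_1 => M 0 0)); rewrite !mxE mulr1n.
pose N : 'M[R]_n := lin1_mx (fun X => brk A X x).
have NE X : X *m N = brk A X x by exact/mul_rV_lin1_linear/brk_linearl.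
have skew : N *m K = - (K *m N^T).
  apply: mx_rV_ext => X; rewrite mulmxN !mulmxA NE.
  apply/rowP => j; rewrite KE !mxE.
  have -> : \sum_k (X *m K) 0 k * N^T k j = (X *m K *m (row j N)^T) 0 0.
    by rewrite mxE; apply: eq_bigr => k _; rewrite !mxE.
  rewrite KT rowE NE mxE mulr1n brkC killingC linearN /= killingC.
  by rewrite -killing_brk brkC linearN.
(* v K is orthogonal to the kernel of N, hence is in the row space of N^T. *)
have /submxP[W vK] : (v *m K <= N^T)%MS.
  rewrite submxE; apply/eqP/rowP => k; rewrite [RHS]mxE.
  pose Z := (col k (cokermx N^T))^T.
  have Zx : brk A Z x = 0.
    rewrite -NE; apply: trmx_inj; rewrite trmx_mul trmx0 [Z^T]trmxK colE.
    by rewrite mulmxA mulmx_coker mul0mx.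
  have := KT v Z; rewrite (orth _ Zx) [Z^T]trmxK colE mulmxA -colE.
  by move=> /(congr1 (fun M : 'M[R]_1 => M 0 0)); rewrite !mxE mul0rn.
have Ku : K \in unitmx by rewrite -row_free_unit.
exists (- (W *m invmx K)); rewrite -NE mulNmx -mulmxA.
have -> : invmx K *m N = - (N^T *m invmx K).
  rewrite -[N in LHS](mulmxK Ku) skew mulNmx mulmxN !mulmxA mulVmx //.
  by rewrite mul1mx.
by rewrite mulmxN opprK mulmxA -vK mulmxK.
Qed.

End OrbitTangent.

(** * Orbits, graphs and the Kirillov-Kostant-Souriau form *)

Lemma has_dim_tangent (R : realType) (n : nat)
    (N : set ('rV[R]_n * 'rV[R]_n)) (d : nat) :
  (forall p, N p -> exists2 W : {vspace ('rV[R]_n * 'rV[R]_n)},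
     \dim W = d & forall v, tangent N p v <-> v \in W) ->
  has_dim N d.
Proof.
move=> NW p Np; have [W Wd tW] := NW p Np; split.
  exists (vbasis W); rewrite size_tuple; split=> //.
    by have := vbasisP W; rewrite basisEfree => /andP[].
  by move=> v /vbasis_mem/tW.
move=> s s_free ts; rewrite -Wd; move: s_free; rewrite /free => /eqP <-.
by apply: dimvS; apply/span_subvP => v /ts /tW.
Qed.

Section OrbitGeometry.
Variables (R : realType) (n : nat) (G : groupType) (A : adjoint_rep R n G).
Implicit Types (g h m : G) (x y X Y Z : 'rV[R]_n).
Local Notation "⟪ X , Y ⟫" := (brk A X Y).
Local Notation Ad := (Adj A).
Local Notation killing := (killing_form (brk A)).

Definition adj_orbit x : set 'rV[R]_n := [set Ad g x | g in [set: G] ].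

Definition adj_graph m x : set ('rV[R]_n * 'rV[R]_n) :=
  [set (y, - Ad m y) | y in adj_orbit x].

Lemma adj_orbit_shift g x : adj_orbit (Ad g x) = adj_orbit x.
Proof.
apply/seteqP; split=> y [h _ <-]; first by rewrite -AdjM; exists (h * g)%g.
by exists (h * g^-1)%g => //; rewrite -AdjM mulgVK.
Qed.

Definition brk_image x : {vspace 'rV[R]_n} := limg (linfun (brk A ^~ x)).

Lemma mem_brk_image x v : v \in brk_image x <-> exists X, v = ⟪X, x⟫.
Proof.
have lin : linear (brk A ^~ x) by exact: brk_linearl.
pose L := HB.pack_for {linear 'rV[R]_n -> 'rV[R]_n} (brk A ^~ x)
  (GRing.isLinear.Build _ _ _ _ _ lin).
have LE X : linfun (brk A ^~ x) X = ⟪X, x⟫ by exact: (lfunE L).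
split=> [/memv_imgP[X _ ->]|[X ->]]; first by exists X.
by rewrite -LE memv_img ?memvf.
Qed.

Lemma dim_brk_image g x : \dim (brk_image (Ad g x)) = \dim (brk_image x).
Proof.
have fE X : linfun (Ad g) X = Ad g X by exact: lfunE.
have -> : brk_image (Ad g x) = (linfun (Ad g) @: brk_image x)%VS.
  apply/vspaceP => v; apply/idP/memv_imgP.
    move=> /mem_brk_image[X ->]; exists ⟪Ad (g^-1)%g X, x⟫.
      by apply/mem_brk_image; exists (Ad (g^-1)%g X).
    by rewrite fE Adj_brk AdjVK.
  move=> [w /mem_brk_image[X ->] ->]; rewrite fE Adj_brk.
  by apply/mem_brk_image; exists (Ad g X).
apply: limg_dim_eq; apply/eqP; rewrite -subv0; apply/subvP => v.
rewrite memv_cap memv_ker fE memv0 => /andP[_ /eqP gv0].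
by rewrite -(AdjK A g v) gv0 linear0.
Qed.

Lemma dim_brk_imageN x : \dim (brk_image (- x)) = \dim (brk_image x).
Proof.
congr (\dim _); apply/vspaceP => v; apply/idP/idP => /mem_brk_image[X ->].
  by apply/mem_brk_image; exists (- X); rewrite brkNr brkNl.
by apply/mem_brk_image; exists (- X); rewrite brkNl brkNr opprK.
Qed.

(** The components of a curve in a product of orbits are curves in the orbits, and
    conversely two curves in the orbits can be run independently. *)
Lemma tangent_orbit_prod x y p v : (adj_orbit x `*` adj_orbit y) p ->
  tangent (adj_orbit x `*` adj_orbit y) p v <->
  v.1 \in brk_image p.1 /\ v.2 \in brk_image p.2.
Proof.
move: p v => [a b] [v w] [/= [g _ ga] [h _ hb]]; split.
  move=> [c [c0 cO dc]]; split; apply/mem_brk_image.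
    apply: (orbit_velocity (A := A) (gamma := fun t => (c t).1)).
    - by rewrite c0.
    - move=> t; have [[k _ <-] _] := cO t.
      by exists (k * g^-1)%g; rewrite /= -ga AdjM AdjK.
    - exact: (is_derive_fst dc).
  apply: (orbit_velocity (A := A) (gamma := fun t => (c t).2)).
  - by rewrite c0.
  - move=> t; have [_ [k _ <-]] := cO t.
    by exists (k * h^-1)%g; rewrite /= -hb AdjM AdjK.
  - exact: (is_derive_snd dc).
move=> [/mem_brk_image[X ->] /mem_brk_image[Y ->]].
exists (fun t => (Ad (flow A X t) a, Ad (flow A Y t) b)); split.
- by rewrite !flow0 !Adj1.
- move=> t; split; rewrite /= -?ga -?hb -AdjM.
    by exists (flow A X t * g)%g.
  by exists (flow A Y t * h)%g.
- by apply: is_derive_pair; exact: is_derive_Adj.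
Qed.

(** The graph projects to the orbit, so the first component of a velocity is a
    bracket; the second one is determined by it, the map being linear. *)
Lemma tangent_graph m x p v : adj_graph m x p ->
  tangent (adj_graph m x) p v <-> exists X, v = (⟪X, p.1⟫, - Ad m ⟪X, p.1⟫).
Proof.
move=> [a [g _ ga] <-] /=; split.
  move=> [c [c0 cO dc]].
  have [X vX] : exists X, v.1 = ⟪X, a⟫.
    apply: (orbit_velocity (A := A) (gamma := fun t => (c t).1)).
    - by rewrite c0.
    - move=> t; have [_ [k _ <-] <-] := cO t.
      by exists (k * g^-1)%g; rewrite /= -ga AdjM AdjK.
    - exact: (is_derive_fst dc).
  exists X; rewrite -vX.
  have lin : linear (fun y => - Ad m y).
    by move=> r y z; rewrite linearP opprD scalerN.
  have c2 : (fun t => (c t).2) = (fun y => - Ad m y) \o (fun t => (c t).1).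
    by apply/funext => t /=; have [y _ <-] := cO t.
  have := is_derive_snd dc; rewrite c2 => dc2.
  have := is_derive_linear lin (rV_linear_continuous lin) (is_derive_fst dc).
  by move=> /(is_derive_unique dc2); case: v {dc dc2} vX => v1 v2 /= _ ->.
move=> [X ->].
exists (fun t => (Ad (flow A X t) a, - Ad m (Ad (flow A X t) a))); split.
- by rewrite !flow0 !Adj1.
- move=> t; exists (Ad (flow A X t) a) => //.
  by rewrite -ga -AdjM; exists (flow A X t * g)%g.
- have lin : linear (fun y => - Ad m y).
    by move=> r y z; rewrite linearP opprD scalerN.
  apply: is_derive_pair; first exact: is_derive_Adj.
  exact: (is_derive_linear lin (rV_linear_continuous lin) (is_derive_Adj A X a)).
Qed.

Lemma graph_has_dim m x : has_dim (adj_graph m x) (\dim (brk_image x)).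
Proof.
apply: has_dim_tangent => p gp.
have lin : linear (fun y => (y, - Ad m y)).
  by move=> r y z; rewrite linearP opprD -scalerN.
pose L := HB.pack_for {linear 'rV[R]_n -> ('rV[R]_n * 'rV[R]_n)%type}
  (fun y => (y, - Ad m y)) (GRing.isLinear.Build _ _ _ _ _ lin).
exists (linfun L @: brk_image p.1)%VS.
  have [y [g _ <-] <-] := gp; rewrite -(dim_brk_image g x); apply: limg_dim_eq.
  apply/eqP; rewrite -subv0; apply/subvP => v.
  by rewrite memv_cap memv_ker lfunE memv0 => /andP[_ /eqP[-> _]].
move=> v; rewrite (tangent_graph _ gp); split=> [[X ->]|/memv_imgP[w]].
  rewrite -[(_, _)](lfunE L) memv_img //.
  by apply/mem_brk_image; exists X.
by move=> /mem_brk_image[X ->] ->; exists X; rewrite lfunE.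
Qed.

Lemma orbit_prod_has_dim x :
  has_dim (adj_orbit x `*` adj_orbit (- x)) (\dim (brk_image x)).*2.
Proof.
apply: has_dim_tangent => p op.
have linl : linear (fun y => (y, 0) : 'rV[R]_n * 'rV[R]_n).
  by move=> r y z; congr (_, _); rewrite /= scaler0 addr0.
have linr : linear (fun y => (0, y) : 'rV[R]_n * 'rV[R]_n).
  by move=> r y z; congr (_, _); rewrite /= scaler0 addr0.
pose Ll := HB.pack_for {linear 'rV[R]_n -> ('rV[R]_n * 'rV[R]_n)%type}
  (fun y => (y, 0) : 'rV[R]_n * 'rV[R]_n) (GRing.isLinear.Build _ _ _ _ _ linl).
pose Lr := HB.pack_for {linear 'rV[R]_n -> ('rV[R]_n * 'rV[R]_n)%type}
  (fun y => (0, y) : 'rV[R]_n * 'rV[R]_n) (GRing.isLinear.Build _ _ _ _ _ linr).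
exists (linfun Ll @: brk_image p.1 + linfun Lr @: brk_image p.2)%VS.
  rewrite dimv_disjoint_sum; last first.
    apply/eqP; rewrite -subv0; apply/subvP => v; rewrite memv_cap memv0.
    case/andP=> /memv_imgP[a _ ->] /memv_imgP[b _]; rewrite !lfunE /=.
    by case=> -> _.
  have injl : (brk_image p.1 :&: lker (linfun Ll) = 0)%VS.
    apply/eqP; rewrite -subv0; apply/subvP => v.
    by rewrite memv_cap memv_ker lfunE memv0 => /andP[_ /eqP[->]].
  have injr : (brk_image p.2 :&: lker (linfun Lr) = 0)%VS.
    apply/eqP; rewrite -subv0; apply/subvP => v.
    by rewrite memv_cap memv_ker lfunE memv0 => /andP[_ /eqP[->]].
  rewrite (limg_dim_eq injl) (limg_dim_eq injr).
  have [[g _ <-] [h _ <-]] := op.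
  by rewrite !dim_brk_image dim_brk_imageN addnn.
move=> v; rewrite (tangent_orbit_prod _ op); split.
  case: v => v w [/= vX wY].
  have -> : (v, w) = linfun Ll v + linfun Lr w.
    by rewrite !lfunE /=; congr (_, _); rewrite /= ?addr0 ?add0r.
  by rewrite memv_add // memv_img.
move=> /memv_addP[_ /memv_imgP[a aX ->] [_ /memv_imgP[b bY ->] ->]].
by rewrite !lfunE /= addr0 add0r.
Qed.

Lemma graph_isotropic m x p v w : adj_graph m x p ->
  tangent (adj_graph m x) p v -> tangent (adj_graph m x) p w ->
  kks_form A p.1 v.1 w.1 + kks_form A p.2 v.2 w.2 = 0.
Proof.
move=> gp /(tangent_graph _ gp)[X ->] /(tangent_graph _ gp)[Y ->] /=.
have [y _ <-] := gp; rewrite /= !Adj_brk -!brkNr !kks_brk.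
by rewrite -Adj_brk (killingC A (- _)) linearN /= killingC killing_Adj killingC subrr.
Qed.

(** The orbits of the subgroup of the pairs (g, m g m^-1). *)
Definition twisted_orbit m (p : 'rV[R]_n * 'rV[R]_n) :
    set ('rV[R]_n * 'rV[R]_n) :=
  [set (Ad g p.1, Ad (m * g * m^-1)%g p.2) | g in [set: G] ].

Lemma twisted_orbit_id m p : twisted_orbit m p p.
Proof. by exists 1%g => //; rewrite mulg1 mulgV !Adj1; case: p. Qed.

(** The map - Ad(m) intertwines the actions of g and of m g m^-1. *)
Lemma twisted_orbit_graph m x y : adj_orbit x y ->
  twisted_orbit m (y, - Ad m y) = adj_graph m x.
Proof.
move=> [h _ hy].
have gE g : Ad (m * g * m^-1)%g (- Ad m y) = - Ad m (Ad g y).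
  by rewrite linearN /= -!AdjM mulgVK.
apply/seteqP; split=> z [] => [g _ <-|_ [g _ <-] <-].
  rewrite /= gE; exists (Ad g y) => //.
  by rewrite -hy -AdjM; exists (g * h)%g.
by exists (g * h^-1)%g => //; rewrite /= gE -hy -AdjM mulgVK.
Qed.

Lemma tangent_twisted_orbit m x y X :
  tangent (twisted_orbit m (x, y)) (x, y) (⟪X, x⟫, ⟪Ad m X, y⟫).
Proof.
exists (fun t => (Ad (flow A X t) x, Ad (m * flow A X t * m^-1)%g y)); split.
- by rewrite flow0 mulg1 mulgV !Adj1.
- by move=> t; exists (flow A X t).
- apply: is_derive_pair; first exact: is_derive_Adj.
  have := is_derive_linear (Adj_linear A m)
    (rV_linear_continuous (Adj_linear A m)) (is_derive_Adj A X (Ad (m^-1)%g y)).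
  rewrite Adj_brk AdjVK.
  have -> // : Ad m \o (fun t => Ad (flow A X t) (Ad (m^-1)%g y)) =
    (fun t => Ad (m * flow A X t * m^-1)%g y).
  by apply/funext => t; rewrite /= -!AdjM.
Qed.

(** Already the velocities of the action force the sum x + Ad(m)^-1 y to be
    orthogonal to all brackets. *)
Lemma isotropic_twisted_orbit m x y :
  (forall v w, tangent (twisted_orbit m (x, y)) (x, y) v ->
     tangent (twisted_orbit m (x, y)) (x, y) w ->
     kks_form A x v.1 w.1 + kks_form A y v.2 w.2 = 0) ->
  y = - Ad m x.
Proof.
move=> iso; suff : x + Ad (m^-1)%g y = 0.
  move=> /(congr1 (Ad m)); rewrite linearD linear0 /= AdjVK => /eqP.
  by rewrite addrC addr_eq0 => /eqP.
apply: (killing_brk_eq0 (A := A)) => X Y.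
rewrite killingC linearD /= !(killingC A ⟪X, Y⟫) -[X in _ + X](killing_Adj A m).
rewrite AdjVK Adj_brk -!kks_brk.
exact: (iso _ _ (tangent_twisted_orbit _ _ _ _) (tangent_twisted_orbit _ _ _ _)).
Qed.

End OrbitGeometry.

(** * Compact semisimple groups *)

Section CompactGroup.
Variables (R : realType) (n : nat) (U : lieGroupType R n) (phi : chart R n U).
Hypothesis hphi : chart_at_one phi.

(** Continuity at the identity is differentiability in the chart there; it is
    carried elsewhere by Ad(h) = Ad(h g^-1) Ad(g). *)
Lemma Ad_continuous (Y : 'rV[R]_n) : continuous (fun g : U => Ad phi g Y).
Proof.
have cont1 (Z : 'rV[R]_n) : {for (1%g : U), continuous (fun g : U => Ad phi g Z)}.
  have cAd := differentiable_continuous (Ad_cinv_differentiable hphi Z).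
  have cmap1 := cmap_continuous hphi.2.
  have : (fun p => Ad phi (cinv phi p) Z) \o cmap phi @ (1%g : U) --> Ad phi 1%g Z.
    have : (fun p => Ad phi (cinv phi p) Z) \o cmap phi @ (1%g : U) -->
        Ad phi (cinv phi (cmap phi 1%g)) Z by exact: (continuous_comp cmap1 cAd).
    by rewrite (cmapK hphi.2).
  apply: cvg_trans; apply: near_eq_cvg.
  by apply: filterS (nbhs_cdom hphi.2) => g dg /=; rewrite cmapK.
move=> g.
have -> : (fun h : U => Ad phi h Y) =
    (fun h => Ad phi h (Ad phi g Y)) \o (fun h => 1 * h * g^-1)%g.
  by apply/funext => h; rewrite /= -(AdM hphi) mul1g mulgVK.
apply: continuous_comp; first exact: translation_continuous.
by rewrite mul1g mulgV; exact: cont1.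
Qed.

Hypothesis hcompact : compact [set: U].
Hypothesis hsemisimple : semisimple phi.

Lemma Ad_bounded (Y : 'rV[R]_n) : exists M : R, forall g : U, `|Ad phi g Y| <= M.
Proof.
have cY : {within [set: U], continuous (fun g : U => Ad phi g Y)}.
  by apply: continuous_subspaceT; exact: Ad_continuous.
have /compact_bounded [M [_ Mb]] := continuous_compact cY hcompact.
exists (M + 1) => g; apply: (Mb (M + 1)); first by rewrite ltrDl.
by exists g.
Qed.

Lemma cinv_line0 (X : 'rV[R]_n) : cinv phi (cmap phi 1%g + (0 : R) *: X) = 1%g.
Proof. by rewrite scale0r addr0 cmapK //; exact: hphi.2. Qed.

Definition adjoint_rep_of_group : adjoint_rep R n U :=
  AdjointRep (Ad_linear hphi) (Ad1 hphi) (AdM hphi)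
    (bracket_linearl hphi) (bracket_linearr hphi) (Ad_bracket hphi)
    cinv_line0 (is_derive_Ad hphi) Ad_bounded hsemisimple.

End CompactGroup.

Theorem proposition5p5 (R : realType) (n : nat) (U : lieGroupType R n)
  (phi : chart R n U) (hphi : chart_at_one phi)
  (hcompact : compact [set: U]) (hconnected : connected [set: U])
  (hsemisimple : semisimple phi)
  (T : set U) (hT : maximal_torus T)
  (r : nat) (Sigma : 'I_r -> 'rV[R]_n * 'rV[R]_n -> R)
  (hSigma : simple_system phi T Sigma)
  (w0 : U) (hw0 : longest phi T Sigma w0)
  (H : 'rV[R]_n * 'rV[R]_n) (hH : closure (positive_chamber phi T Sigma) H)
  (m : U) :
  let F := flag phi H in
  let Fdual := flag phi (sigma phi w0 H) in
  (exists! O, is_orbit phi (Delta m) (F `*` Fdual) O /\ isotropic phi O) /\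
  (forall O, is_orbit phi (Delta m) (F `*` Fdual) O -> isotropic phi O ->
     lagrangian phi (F `*` Fdual) O /\
     O = [set (x, - Ad phi m x) | x in F]).
Proof.
pose A := adjoint_rep_of_group hphi hcompact hsemisimple.
move=> F Fdual; pose x0 := - H.2.
have FE : F = adj_orbit A x0 by [].
(* The minus sign comes from sigma, and Ad(w0) leaves the orbits unchanged. *)
have FdualE : Fdual = adj_orbit A (- x0).
  have imE : (imul (sigma phi w0 H)).1 = Adj A w0 (- x0) by rewrite /= !opprK.
  by rewrite /Fdual /flag imE -(adj_orbit_shift A w0).
have orbitE p : [set act phi k p | k in Delta m] = twisted_orbit A m p.
  exact: image_comp.
have isotropicE O : isotropic phi O -> forall p v w, O p -> tangent O p v ->
    tangent O p w -> kks_form A p.1 v.1 w.1 + kks_form A p.2 v.2 w.2 = 0 by [].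
rewrite {}FE {}FdualE -/x0 -[[set _ | _ in _]]/(adj_graph A m x0).
have graph_orbit : is_orbit phi (Delta m) (adj_orbit A x0 `*` adj_orbit A (- x0))
    (adj_graph A m x0).
  have x0F : adj_orbit A x0 x0 by exists 1%g => //; rewrite Adj1.
  exists (x0, - Adj A m x0); last by rewrite orbitE (twisted_orbit_graph m x0F).
  by split=> //=; exists m => //; exact: (linearN (Adj A m)).
have graph_isotropic' : isotropic phi (adj_graph A m x0).
  by move=> p v w; exact: graph_isotropic.
have iso_graph O : is_orbit phi (Delta m) (adj_orbit A x0 `*` adj_orbit A (- x0)) O ->
    isotropic phi O -> O = adj_graph A m x0.
  move=> [[x y] [/= xF _] ->]; rewrite orbitE => /isotropicE iso.
  have -> : y = - Adj A m x.
    apply: isotropic_twisted_orbit => v w.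
    exact: iso (twisted_orbit_id A m (x, y)).
  exact: twisted_orbit_graph.
split.
  by exists (adj_graph A m x0); split=> // O [orbO isoO]; rewrite (iso_graph O).
move=> O orbO isoO; rewrite (iso_graph O) //; split=> //; split=> //.
exists (\dim (brk_image A x0)); split; first exact: graph_has_dim.
exact: orbit_prod_has_dim.
Qed.
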